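(* Let $(E,d)$ be a Polish space whose distance $d$ is bounded by $1$, and let $P$ be a Markov kernel on $(E,\mathcal{B}(E))$. Assume that there exist: (i) a coupling kernel $Q$ for $P$, a set $\Delta\in\mathcal{B}(E\times E)$, an integer $\ell\ge 1$ and $\epsilon>0$ such that $Qd(x,y)\le d(x,y)$ for every $x,y\in E$, and $Q^{\ell}d(x,y)\le(1-\epsilon)d(x,y)$ for every $(x,y)\in\Delta$; (ii) a measurable function $\mathcal{V}:E\times E\to[1,\infty)$ and a constant $b<\infty$ such that $$Q\mathcal{V}(x,y)\le\mathcal{V}(x,y)-1+b\,\mathbf{1}_{\Delta}(x,y)\quad\text{for all }x,y\in E,\qquad \sup_{(x,y)\in\Delta}Q^{\ell-1}\mathcal{V}(x,y)<+\infty;$$ (iii) an increasing sequence of integers $\{n_k,k\in\mathbb{N}\}$, a concave function $\psi:\mathbb{R}_+\to\mathbb{R}_+$ with $\lim_{v\to+\infty}\psi(v)=+\infty$, and a point $x_0\in E$ such that, with $\mathcal{V}_{x_0}=\mathcal{V}(x_0,\cdot)$, $$\sup_{k\in\mathbb{N}}P^{n_k}[\psi\circ\mathcal{V}_{x_0}](x_0)<+\infty,\qquad P\mathcal{V}_{x_0}(x_0)<+\infty.$$ Then $P$ admits a unique invariant probability distribution.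
   Context: A coupling kernel for a Markov kernel $P$ on $(E,\mathcal{B}(E))$ is a Markov kernel $Q$ on $(E\times E,\mathcal{B}(E\times E))$ such that for every $x,y\in E$ the probability $Q((x,y),\cdot)$ has first marginal $P(x,\cdot)$ and second marginal $P(y,\cdot)$. For a kernel $K$ and a nonnegative measurable function $f$, $Kf(x)=\int f(z)\,K(x,dz)$, and $K^n$ is the $n$-th iterate of $K$ ($K^0$ is the identity kernel). *)

(* Defs.v *)
From HB Require Import structures.
From mathcomp Require Import all_boot all_order all_algebra.
From mathcomp Require Import all_classical all_reals all_analysis.

Set Implicit Arguments.
Unset Strict Implicit.
Unset Printing Implicit Defensive.

Import Order.TTheory GRing.Theory Num.Theory.
Import numFieldTopology.Exports.

Local Open Scope classical_set_scope.
Local Open Scope ring_scope.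
Local Open Scope ereal_scope.

(* The [Pointed] requirement comes from [measurableType], whose carriers are
   nonempty by definition; separability is kept as a separate predicate. *)
#[short(type=completeMetricType)]
HB.structure Definition CompleteMetric (R : numDomainType) :=
  {M of Metric R M & CompletePseudoMetric R M}.

Definition separable (T : topologicalType) : Prop :=
  exists2 D : set T, countable D & dense D.

(* For T = E * E this is the sigma-algebra generated by the open sets of the
   product topology, not the product of the Borel sigma-algebras of the
   factors; that the two agree when E is separable is a theorem. *)
Notation borel T := (g_sigma_algebraType (@open T%type)).

Section markov_kernels.
Context d (X : measurableType d) (R : realType).

Definition kapp (K : X -> {measure set X -> \bar R}) (f : X -> \bar R) (x : X)
  : \bar R := \int[K x]_z f z.

Fixpoint kiter (K : R.-spker X ~> X) (n : nat) : R.-spker X ~> X :=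
  if n is m.+1 then mkcomp_noparam K (kiter K m)
  else kdirac (@measurable_id _ X setT).

(* Measures are compared on measurable sets only: the underlying function
   set X -> \bar R is unconstrained on non-measurable sets. *)
Definition invariant_probability (P : R.-pker X ~> X) (mu : probability X R)
  : Prop :=
  forall A : set X, measurable A -> \int[mu]_x P x A = mu A.

End markov_kernels.

Definition coupling_kernel (R : realType) (E : completeMetricType R)
    (P : R.-pker borel E ~> borel E)
    (Q : R.-pker borel (E * E) ~> borel (E * E)) : Prop :=
  forall (x y : E) (A : set (borel E)), measurable A ->
    Q (x, y) (fst @^-1` A) = P x A /\ Q (x, y) (snd @^-1` A) = P y A.

Definition concave_function (R : realType) (D : set R) (f : R -> R) : Prop :=
  @convex_function R R^o D (fun x => (- f x)%R).

(* Main.v *)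
From HB Require Import structures.
Require Import Defs.
From mathcomp Require Import all_boot all_order all_algebra.
From mathcomp Require Import all_classical all_reals all_analysis.
From mathcomp Require Import measurable_realfun ring lra.

Set Implicit Arguments.
Unset Strict Implicit.
Unset Printing Implicit Defensive.

Import Order.TTheory GRing.Theory Num.Theory.
Import numFieldTopology.Exports.

Local Open Scope classical_set_scope.
Local Open Scope ring_scope.

(** Let [u_n(x,y)] be the mean distance after [n] steps of the chain driven by
    [Q] started at [(x,y)], and let [P^n f] be the mean of [f] after [n] steps
    of [P].  Since [Q] couples [P] with itself,
    [|P^n f(x) - P^n f(y)| <= u_n(x,y)] for every 1-Lipschitz [f] valued in
    [[0,1]], so everything rests on the decay of [u_n] and on a completeness
    property of probabilities.

    Decay ([drift_decay]).  With [delta] the contraction factor on [Delta],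
      [n u_n <= n delta^m d + V + c m]   for all [m] and [n].
    The induction on [m], and on [n] for fixed [m], replaces the study of return
    times to [Delta]: off [Delta] one step costs 1, which the drift of [V] pays;
    on [Delta] one jumps [l] steps ahead, gains a factor [delta], and the constant
    [c] pays for the [l] steps and for the growth of [V].  Choosing [m] first and
    [n] next, [u_n] tends to 0, uniformly on sets where [V] is bounded.

    Uniqueness ([invariant_unique]).  If [mu] is invariant, then
    [|mu(f) - P^n f(x)|] is at most the [mu]-mean of [u_n(x,.)], which tends to
    0 by bounded convergence.  Hence [mu(f)] is the limit of [P^n f(x)] for every
    test function [f], whatever [mu] is.

    Existence ([invariant_exists]).  The law after [n_j + n_k] steps from [x0]
    is compared with the laws after [n_k] and after [n_j] steps: conditioning
    on the first [n_j] steps bounds the first difference by the mean of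
    [u_{n_k}(x0,.)] under [P^{n_j}(x0,.)].  By concavity
    [min(1, V/n) <= psi(V) / psi(n)], so the assumed bound on the means of
    [psi(V)] makes this small uniformly in [j] ([mean_cost_uniform]).  The laws at
    times [n_k] thus form a Cauchy sequence, uniformly over test functions.  Its
    limit is invariant because [P^{n_k+1} f(x0) - P^{n_k} f(x0)] tends to 0.

    Completeness ([bounded_lipschitz_complete]).  The limit [L] of a sequence of
    probabilities that is Cauchy uniformly over bounded Lipschitz functions is
    represented by a probability.  Being a uniform limit of measures that are
    tight, [L] is tight, hence continuous along decreasing sequences of test
    functions ([functional_sigma_smooth]).  The inner mass
    [sup {L f | f <= 1_U}] of open sets is then countably subadditive and
    generates an outer measure for which open sets are Caratheodory measurable;
    cutting test functions into thin strips identifies its integral with [L]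
    ([functional_representation]). *)

(** * Bounded Lipschitz test functions *)

Lemma superlevel_measurable (R : realType) (T : pointedType) (G : set (set T))
    (f : T -> R) : (forall r, G [set x | r < f x]) ->
  measurable_fun [set: g_sigma_algebraType G] f.
Proof.
move=> Gf; apply: (measurability _ (RGenOInfty.measurableE R)) => _ /= [_ [r ->] <-].
apply: sub_sigma_algebra.
rewrite setTI [X in G X](_ : _ = [set x | r < f x]) //.
by apply/seteqP; split => x /=; rewrite in_itv/= andbT.
Qed.

Lemma preimage_measurable (S T : pointedType) (G : set (set S)) (H : set (set T))
    (f : S -> T) : (forall U, H U -> G (f @^-1` U)) ->
  measurable_fun [set: g_sigma_algebraType G]
    (f : g_sigma_algebraType G -> g_sigma_algebraType H).
Proof.
move=> Gf.
have HT : @measurable _ (g_sigma_algebraType H) = <<s H >> by [].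
refine (measurability _ HT _) => _ /= [U HU <-].
by apply: sub_sigma_algebra; rewrite setTI; exact: Gf.
Qed.

Section bounded_lipschitz.
Context {R : realType} {E : metricType R}.
Implicit Types (f g : E -> R) (c a : R).

(** Nonnegativity lets test functions be integrated against iterated kernels in
    the extended reals without integrability conditions; a single constant for
    the bound and the slope keeps track of both under the operations below. *)
Definition blip c f :=
  (forall x, 0 <= f x <= c) /\ (forall x y, f x - f y <= c * mdist x y).

Lemma blip_ge0 c f x : blip c f -> 0 <= f x.
Proof. by move=> [/(_ x)/andP[]]. Qed.

Lemma blip_le c f x : blip c f -> f x <= c.
Proof. by move=> [/(_ x)/andP[]]. Qed.

Lemma blip_bound_ge0 c f (x : E) : blip c f -> 0 <= c.
Proof. by move=> fc; rewrite (le_trans (blip_ge0 x fc)) // (blip_le x fc). Qed.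

Lemma blip_lipschitz c f x y : blip c f -> f x <= f y + c * mdist x y.
Proof. by move=> [_ /(_ x y)]; rewrite lerBlDl. Qed.

Lemma blip_cst c a : 0 <= a -> a <= c -> blip c (fun=> a).
Proof.
move=> a0 ac; split => [x|x y]; first by rewrite a0.
by rewrite subrr mulr_ge0 ?mdist_ge0 ?(le_trans a0).
Qed.

Lemma blip_weaken c c' f : c <= c' -> blip c f -> blip c' f.
Proof.
move=> cc' [f0c fc]; split => [x|x y].
  by have /andP[-> /le_trans ->] := f0c x.
by rewrite (le_trans (fc x y)) // ler_wpM2r ?mdist_ge0.
Qed.

Lemma blipD c c' f g : blip c f -> blip c' g -> blip (c + c') (fun x => f x + g x).
Proof.
move=> [f0c fc] [g0c gc]; split => [x|x y].
  by have /andP[? ?] := f0c x; have /andP[? ?] := g0c x; rewrite addr_ge0 // lerD.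
by rewrite opprD addrACA mulrDl lerD.
Qed.

Lemma blipZ c a f : 0 <= a -> blip c f -> blip (a * c) (fun x => a * f x).
Proof.
move=> a0 [f0c fc]; split => [x|x y].
  by have /andP[? ?] := f0c x; rewrite mulr_ge0 // ler_wpM2l.
by rewrite -mulrBr -mulrA ler_wpM2l.
Qed.

Lemma blip_min c a f : 0 <= a -> blip c f -> blip c (fun x => Num.min (f x) a).
Proof.
move=> a0 bf; split => [x|x y].
  by rewrite le_min (blip_ge0 x bf) a0 /= ge_min (blip_le x bf).
have := blip_lipschitz x y bf; have := blip_bound_ge0 x bf.
have := mdist_ge0 x y; rewrite /Num.min; case: ifPn; case: ifPn; rewrite -?leNgt;
  nra.
Qed.

Lemma blip_excess c c' f g : blip c f -> blip c' g ->
  blip (c + c') (fun x => Num.max (f x - g x) 0).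
Proof.
move=> bf bg; split => [x|x y].
  rewrite le_max lexx orbT /= ge_max.
  have := blip_le x bf; have := blip_ge0 x bg; have := blip_le x bg.
  by have := blip_ge0 x bf; lra.
have := blip_lipschitz x y bf; have := blip_lipschitz y x bg; rewrite (metric_sym y x).
have := blip_bound_ge0 x bf; have := blip_bound_ge0 x bg.
have := mdist_ge0 x y; rewrite /Num.max; case: ifPn; case: ifPn; rewrite -?leNgt;
  nra.
Qed.

Lemma blip_opp c f : blip c f -> blip c (fun x => c - f x).
Proof.
move=> bf; split => [x|x y].
  by have := blip_le x bf; have := blip_ge0 x bf; lra.
by have := blip_lipschitz y x bf; rewrite metric_sym; lra.
Qed.

Lemma blip_superlevel_open c f r : blip c f -> open [set x | r < f x].
Proof.
move=> bf; rewrite openE => x /= rfx; apply/nbhs_ballP.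
have c0 := blip_bound_ge0 x bf.
exists ((f x - r) / (c + 1)) => /=; first by rewrite divr_gt0 ?subr_gt0 //; lra.
move=> y; rewrite ballEmdist /= ltr_pdivlMr; last by lra.
have := blip_lipschitz x y bf; have := mdist_ge0 x y; nra.
Qed.

Lemma blip_sublevel_open c f r : blip c f -> open [set x | f x < r].
Proof.
move=> bf; rewrite [X in open X](_ : _ = [set x | c - r < c - f x]); last first.
  by apply/seteqP; split => x /=; lra.
exact: (blip_superlevel_open (c := c)) (blip_opp bf).
Qed.

(** The Pasch-Hausdorff envelope of the indicator of [U]: its largest minorant
    of slope [n.+1].  It increases to the indicator when [U] is open. *)
Definition lip_env (n : nat) (U : set E) (x : E) : R :=
  inf (range (fun y => \1_U y + n.+1%:R * mdist x y)).

Let env_lb n (U : set E) x : lbound (range (fun y => \1_U y + n.+1%:R * mdist x y)) (0 : R).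
Proof. by move=> _ [y _ <-]; rewrite addr_ge0 // mulr_ge0 // mdist_ge0. Qed.

Lemma lip_env_le n U x y : lip_env n U x <= \1_U y + n.+1%:R * mdist x y.
Proof. by apply: ge_inf; [exists 0; exact: env_lb|exists y]. Qed.

Lemma lip_env_glb n U x a : (forall y, a <= \1_U y + n.+1%:R * mdist x y) ->
  a <= lip_env n U x.
Proof.
by move=> aU; apply: lb_le_inf; [exists (\1_U x + n.+1%:R * mdist x x); exists x
  |move=> _ [y _ <-]].
Qed.

Lemma lip_env_le_indic n U x : lip_env n U x <= \1_U x.
Proof. by have := lip_env_le n U x x; rewrite mdistxx mulr0 addr0. Qed.

Lemma blip_lip_env n U : blip n.+1%:R (lip_env n U).
Proof.
split => [x|x y].
  rewrite lip_env_glb /=; last by move=> y; apply: (@env_lb n U x); exists y.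
  rewrite (le_trans (lip_env_le_indic _ _ _)) // (@le_trans _ _ 1) ?ler1n//.
rewrite lerBlDr -lerBlDl; apply: lip_env_glb => z.
have := lip_env_le n U x z; have := metric_triangle x y z.
have := ler0n R n.+1; nra.
Qed.

Lemma lip_env_nondecreasing U x m n : (m <= n)%N -> lip_env m U x <= lip_env n U x.
Proof.
move=> mn; apply: lip_env_glb => y; rewrite (le_trans (lip_env_le m U x y)) //.
by rewrite lerD2l ler_wpM2r ?mdist_ge0 // ler_nat.
Qed.

(** A point of an open set is at distance at least some [r > 0] of the
    complement, so the envelope saturates as soon as the slope exceeds [1/r]. *)
Lemma lip_env_eq1 U x : open U -> U x ->
  exists N, forall n, (N <= n)%N -> lip_env n U x = 1.
Proof.
move=> oU Ux; have /nbhs_ballP[r /= r0 rU] : nbhs x U by exact: open_nbhs_nbhs.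
exists (Num.truncn r^-1) => n nN; apply/eqP; rewrite eq_le; apply/andP; split.
  by rewrite (le_trans (lip_env_le_indic _ _ _)) // indicE; case: (_ \in _).
apply: lip_env_glb => y; have [Uy|nUy] := pselect (U y).
  by rewrite indicE mem_set // lerDl mulr_ge0 // mdist_ge0.
have rxy : r <= mdist x y.
  by rewrite leNgt; apply/negP => xy; apply/nUy/rU; rewrite ballEmdist.
rewrite (@le_trans _ _ (n.+1%:R * mdist x y)) //; last by rewrite lerDr.
rewrite -ler_pdivrMl // mulr1 (le_trans _ rxy) // -[leRHS]invrK lef_pV2 ?posrE ?invr_gt0//.
by rewrite ltW // (lt_le_trans (truncnS_gt _)) // ler_nat.
Qed.

End bounded_lipschitz.

Section integral_of_test_functions.
Context {R : realType} {E : completeMetricType R}.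
Implicit Types (f g : E -> R) (mu : probability (borel E) R).

Lemma blip_measurable c f : blip c f -> measurable_fun [set: borel E] f.
Proof.
by move=> bf; apply: superlevel_measurable => r; exact: blip_superlevel_open bf.
Qed.

Lemma blip_integrable mu c f :
  blip c f -> mu.-integrable [set: borel E] (EFin \o f).
Proof.
move=> bf; apply: measurable_bounded_integrable => //.
- by rewrite /= probability_setT ltry.
- exact: blip_measurable bf.
- exists c; split; first exact: num_real.
  move=> x cx y _ /=; rewrite (le_trans _ (ltW cx)) // ger0_norm ?(blip_le y bf) //.
  exact: blip_ge0 bf.
Qed.

Lemma EFin_Rintegral_blip mu c f : blip c f ->
  (\int[mu]_x f x)%R%:E = (\int[mu]_x (f x)%:E)%E.
Proof.
by move=> bf; rewrite fineK //; apply: integrable_fin_num => //; exact: blip_integrable bf.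
Qed.

Lemma le_Rintegral_blip mu c c' f g : blip c f -> blip c' g ->
  (forall x, f x <= g x) -> \int[mu]_x f x <= \int[mu]_x g x.
Proof.
move=> bf bg fg; apply: le_Rintegral => //.
  exact: blip_integrable bf.
exact: blip_integrable bg.
Qed.

Lemma RintegralD_blip mu c c' f g : blip c f -> blip c' g ->
  \int[mu]_x (f x + g x) = \int[mu]_x f x + \int[mu]_x g x.
Proof.
move=> bf bg; apply: RintegralD => //.
  exact: blip_integrable bf.
exact: blip_integrable bg.
Qed.

Lemma RintegralZ_blip mu c a f : blip c f ->
  \int[mu]_x (a * f x) = a * \int[mu]_x f x.
Proof. by move=> bf; apply: RintegralZl => //; exact: blip_integrable bf. Qed.

Lemma Rintegral_cst_probability mu (a : R) : \int[mu]_x a = a.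
Proof. by rewrite Rintegral_cst //= probability_setT mulr1. Qed.

End integral_of_test_functions.

(** A functional that is, on each class of test functions, a uniform limit of
    probabilities inherits their order and linear structure. *)
Section positive_functional.
Context {R : realType} {E : completeMetricType R}.
Variable L : (E -> R) -> R.
Hypothesis L_approx : forall c e : R, 0 < e ->
  exists mu : probability (borel E) R,
    forall f : E -> R, blip c f -> `|L f - \int[mu]_x f x| <= e.

Lemma functional_le c c' f g : blip c f -> blip c' g ->
  (forall x, f x <= g x) -> L f <= L g.
Proof.
move=> bf bg fg; apply/ler_addgt0Pr => e e0.
have c0 := blip_bound_ge0 point bf; have c'0 := blip_bound_ge0 point bg.
have [mu Lmu] := L_approx (c + c') (divr_gt0 e0 (ltr0Sn _ 1)).
have := Lmu f (blip_weaken (ler_wpDr c'0 (lexx c)) bf).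
have := Lmu g (blip_weaken (ler_wpDl c0 (lexx c')) bg).
have := le_Rintegral_blip mu bf bg fg.
rewrite !ler_norml; lra.
Qed.

Lemma functionalD c c' f g : blip c f -> blip c' g ->
  L (fun x => f x + g x) = L f + L g.
Proof.
move=> bf bg; apply/eqP; rewrite -subr_eq0 -normr_le0; apply/ler_addgt0Pr => e e0.
have c0 := blip_bound_ge0 point bf; have c'0 := blip_bound_ge0 point bg.
have [mu Lmu] := L_approx (c + c') (divr_gt0 e0 (ltr0Sn _ 2)).
have := Lmu f (blip_weaken (ler_wpDr c'0 (lexx c)) bf).
have := Lmu g (blip_weaken (ler_wpDl c0 (lexx c')) bg).
have := Lmu _ (blipD bf bg).
rewrite (RintegralD_blip mu bf bg) !ler_norml; lra.
Qed.

Lemma functionalZ c a f : 0 <= a -> blip c f -> L (fun x => a * f x) = a * L f.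
Proof.
move=> a0 bf; apply/eqP; rewrite -subr_eq0 -normr_le0; apply/ler_addgt0Pr => e e0.
have c0 := blip_bound_ge0 point bf.
have e'0 : 0 < e / (a + 1) by rewrite divr_gt0 //; lra.
have [mu Lmu] := L_approx (a * c + c) e'0.
have ac0 := mulr_ge0 a0 c0.
have := Lmu f (blip_weaken (ler_wpDl ac0 (lexx c)) bf).
have := Lmu _ (blip_weaken (ler_wpDr c0 (lexx _)) (blipZ a0 bf)).
rewrite (RintegralZ_blip mu _ bf) add0r.
set r := e / (a + 1); have er : e = a * r + r.
  by rewrite -[X in _ = _ + X]mul1r -mulrDl mulrC divfK //; lra.
move=> Laf /(ler_wpM2l a0); rewrite -{1}(ger0_norm a0) -normrM mulrBr.
by move: Laf; rewrite !ler_norml => /andP[? ?] /andP[? ?]; apply/andP; split; lra.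
Qed.

Lemma functional_cst a : 0 <= a -> L (fun=> a) = a.
Proof.
move=> a0; apply/eqP; rewrite -subr_eq0 -normr_le0; apply/ler_addgt0Pr => e e0.
have [mu Lmu] := L_approx a e0.
by have := Lmu _ (blip_cst a0 (lexx a)); rewrite Rintegral_cst_probability add0r.
Qed.

Lemma functional_ge0 c f : blip c f -> 0 <= L f.
Proof.
move=> bf; rewrite -(functional_cst (lexx 0)).
apply: (functional_le (blip_cst (lexx 0) (lexx 0)) bf) => x; exact: blip_ge0 bf.
Qed.

Lemma functional_sum (F : nat -> E -> R) n : (forall i, exists c, blip c (F i)) ->
  exists2 c, blip c (fun x => \sum_(i < n) F i x) &
    L (fun x => \sum_(i < n) F i x) = \sum_(i < n) L (F i).
Proof.
move=> bF; elim: n => [|n [c bn IH]].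
  exists 0; under eq_fun do rewrite big_ord0.
    exact: blip_cst.
  by rewrite big_ord0 functional_cst.
have [c' bFn] := bF n; exists (c + c').
  by under eq_fun do rewrite big_ord_recr; exact: blipD.
under eq_fun do rewrite big_ord_recr/=.
by rewrite (functionalD bn bFn) IH big_ord_recr.
Qed.

End positive_functional.

(** * Tightness and sigma-smoothness *)

Lemma bounded_convergence d (T : measurableType d) (R : realType)
    (mu : probability T R) (f_ : nat -> T -> \bar R) (f : T -> \bar R) :
  (forall n, measurable_fun setT (f_ n)) -> measurable_fun setT f ->
  (forall n x, 0 <= f_ n x <= 1)%E -> (forall x, f_ ^~ x @ \oo --> f x) ->
  (\int[mu]_x f_ n x)%E @[n --> \oo] --> (\int[mu]_x f x)%E.
Proof.
move=> mf_ mf f01 ff.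
have [] // := @dominated_convergence _ _ _ mu _ measurableT f_ f (cst 1%E) mf_ mf.
- exact: aeW.
- by apply: finite_measure_integrable_cst.
- by apply: aeW => x n _; have /andP[f0 f1] := f01 n x; rewrite gee0_abs.
Qed.

(** Pigeonhole for ultrafilters: this turns a finite cover into one piece of
    the cover. *)
Lemma ultra_bigcup_ord T (G : set_system T) (B : nat -> set T) N :
  UltraFilter G -> G [set x | exists2 k, (k < N)%N & B k x] ->
  exists k, G (B k).
Proof.
move=> UG; have PG : ProperFilter G by exact: ultra_proper.
elim: N => [|N IH] GB; first by case: (@filter_ex _ _ PG _ GB) => x [].
have [GBN|GBN] := in_ultra_setVsetC (B N) UG; first by exists N.
apply: IH; apply: (filterS _ (filterI GB GBN)) => x [[k]].
by rewrite ltnS leq_eqVlt => /predU1P[->|kN] Bx nBx; last by exists k.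
Qed.

Section sigma_smooth.
Context {R : realType} {E : completeMetricType R}.

Lemma dense_sequence : separable E ->
  exists c : nat -> E, forall x (e : R), 0 < e -> exists i, mdist x (c i) < e.
Proof.
move=> [D cD dD].
have D0 : D !=set0.
  by have [x []] := dD setT (ex_intro _ (point : E) I) openT; exists x.
have [c Dc] : exists c : nat -> E, D `<=` range c.
  have [|f] := pfcard_geP cD; first by move=> D_0; case: D0 => x; rewrite D_0.
  have [g] := f; exists g => x Dx.
  by have [n _ <-] := 'surj_g Dx; exists n.
exists c => x e e0.
have [||y [xy Dy]] := dD (ball x e)^°.
- by exists x; apply: nbhsx_ballx.
- exact: open_interior.
have [i _ ciy] := Dc _ Dy; exists i; rewrite ciy.
by move/interior_subset : xy; rewrite ballEmdist.
Qed.

Variables (c : nat -> E) (c_dense : forall x (e : R), 0 < e -> exists i, mdist x (c i) < e).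

(** A test function that is 1 away from the first [N] points of the dense
    sequence and small near them: [L (far j N)] measures how much mass escapes
    from finitely many balls of radius [1/(j+1)]. *)
Let far j N : E -> R := lip_env j (~` [set c k | k in `I_N]).

Let far_le j N x i : (i < N)%N -> far j N x <= j.+1%:R * mdist x (c i).
Proof.
move=> iN; rewrite (le_trans (lip_env_le j _ x (c i))) // indicE memNset ?add0r//.
by apply; exists i.
Qed.

Let far_lt1 j N x : far j N x < 1 ->
  exists2 k, (k < N)%N & ball (c k) j.+1%:R^-1 x.
Proof.
move=> /inf_lt[|_ [y _ <-]]; first by eexists; exists x.
have [[k kN <-]|ny] := pselect ([set c k | k in `I_N] y).
  rewrite indicE memNset ?add0r; last by apply; exists k.
  move=> h; exists k => //; rewrite ballEmdist /= metric_sym.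
  by rewrite -[ltRHS]mulr1 -ltr_pdivrMl ?invr_gt0// invrK.
by rewrite indicE mem_set // gtrDl ltNge mulr_ge0 // mdist_ge0.
Qed.

Variable L : (E -> R) -> R.
Hypothesis L_approx : forall c e : R, 0 < e ->
  exists mu : probability (borel E) R,
    forall f : E -> R, blip c f -> `|L f - \int[mu]_x f x| <= e.

(** Tightness at one scale.  It holds for a single probability by density and
    bounded convergence, and passes to [L] because the slope of [far j N] does
    not depend on [N]. *)
Let far_small j (e : R) : 0 < e -> exists N, L (far j N) <= e.
Proof.
move=> e0; have e20 : 0 < e / 2 by rewrite divr_gt0.
have [mu Lmu] := L_approx j.+1%:R e20.
have bf N : blip j.+1%:R (far j N) := blip_lip_env _ _.
have : (\int[mu]_x (far j N x)%:E)%E @[N --> \oo] --> (\int[mu]_x (cst 0 x))%E.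
  apply: bounded_convergence => //.
  - by move=> N; apply/measurable_EFinP; exact: blip_measurable (bf N).
  - move=> N x; rewrite !lee_fin (blip_ge0 x (bf N)) /=.
    by rewrite (le_trans (lip_env_le_indic _ _ _)).
  - move=> x; apply: cvg_EFin; first exact: nearW.
    apply/cvgrPdist_le => /= d d0; have := divr_gt0 d0 (ltr0Sn R j).
    move=> /(c_dense x)[i xi]; exists i.+1 => // N /= iN.
    rewrite sub0r normrN ger0_norm ?(blip_ge0 x (bf N)) //.
    by rewrite (le_trans (far_le j x iN)) // -ler_pdivlMl // mulrC ltW.
rewrite integral0 => /fine_cvgP[_ /cvgrPdist_le/(_ _ e20)[N _ /(_ N (leqnn N))]].
rewrite /= sub0r normrN => int_small; exists N.
have := Lmu _ (bf N); rewrite ler_norml => /andP[_].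
by move: int_small; rewrite ler_norml /Rintegral => /andP[_]; lra.
Qed.

(** A Dini argument.  If [f n] were never dominated by [e / 2] plus the escape
    functions of the first [n] scales, there would be points [x_ n] with
    [f n (x_ n) > e / 2] lying close to a finite set at every scale.  By
    completeness these points cluster somewhere, and there [f n] could not tend
    to 0. *)
Lemma functional_sigma_smooth (f : nat -> E -> R) :
  (forall n, exists a, blip a (f n)) -> (forall m n x, (m <= n)%N -> f n x <= f m x) ->
  (forall n x, f n x <= 1) ->
  (forall x (e : R), 0 < e -> exists n, f n x < e) ->
  forall e : R, 0 < e -> exists n, L (f n) <= e.
Proof.
move=> bf f_dec f1 f0 e e0; have e20 : 0 < e / 2 by rewrite divr_gt0.
have e_pow j : 0 < e / 2 * 2^-1 ^+ j.+1 by rewrite mulr_gt0 // exprn_gt0 // invr_gt0.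
(* the geometric weights make the total escaping mass at most e / 2 *)
have [N LN] := choice (fun j => far_small j (e_pow j)).
pose h j := far j (N j).
have bh j : blip j.+1%:R (h j) := blip_lip_env _ _.
have [[n fn]|] := pselect (exists n, forall x, f n x <= e / 2 + \sum_(j < n) h j x).
  exists n; have [a bs Ls] := functional_sum L_approx n
    (fun j => ex_intro (fun a => blip a (h j)) _ (bh j)).
  have [b bfn] := bf n; have be := blip_cst (E:=E) (ltW e20) (lexx _).
  rewrite (le_trans (functional_le L_approx bfn (blipD be bs) fn)) //.
  rewrite (functionalD L_approx be bs) (functional_cst L_approx (ltW e20)) Ls.
  have pow_sum k : \sum_(j < k) e / 2 * 2^-1 ^+ j.+1 = e / 2 - e / 2 * 2^-1 ^+ k.
    elim: k => [|k IH]; first by rewrite big_ord0 expr0; ring.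
    by rewrite big_ord_recr /= IH exprS; field.
  have : \sum_(j < n) L (h j) <= \sum_(j < n) e / 2 * 2^-1 ^+ j.+1.
    by apply: ler_sum => j _; exact: LN.
  rewrite pow_sum; have : 0 < e / 2 * 2^-1 ^+ n by rewrite mulr_gt0 // exprn_gt0.
  by lra.
move=> /forallNP nf.
have {nf} /choice[x_ fx_] n : exists x, e / 2 + \sum_(j < n) h j x < f n x.
  have /existsNP[x] := nf n; move/negP; rewrite -ltNge => ?; by exists x.
have x_near n i : (i < n)%N -> exists2 k, (k < N i)%N & ball (c k) i.+1%:R^-1 (x_ n).
  move=> ni; apply: far_lt1; apply: lt_le_trans (f1 n (x_ n)).
  apply: le_lt_trans (fx_ n); rewrite (bigD1 (Ordinal ni)) //= -/(h i).
  rewrite addrCA lerDl addr_ge0 ?(ltW e20) // sumr_ge0 // => j _.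
  exact: blip_ge0 (bh _).
(* an ultrafilter along the points is Cauchy since it picks one ball per scale *)
have [G [UG xG]] : exists G, UltraFilter G /\ x_ @ \oo `<=` G.
  exact: ultraFilterLemma.
have PG : ProperFilter G by exact: ultra_proper.
have cG : cauchy G.
  apply: cauchy_exP => r r0.
  pose i := Num.truncn r^-1.
  have ir : i.+1%:R^-1 <= r.
    rewrite -[leRHS]invrK lef_pV2 ?posrE ?invr_gt0//.
    by rewrite ltW // truncnS_gt.
  have : G [set x | exists2 k, (k < N i)%N & ball (c k) i.+1%:R^-1 x].
    by apply: xG; exists i.+1 => // n /= ni; exact: x_near.
  move=> /(ultra_bigcup_ord UG)[k Gk]; exists (c k).
  by apply: filterS Gk; exact: le_ball.
have /cvg_ex[x Gx] : cvg G by exact: cauchy_cvg.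
have [m fmx] := f0 x _ e20; have [a bfm] := bf m.
have G1 : G [set y | f m y < e / 2].
  apply: Gx; apply: open_nbhs_nbhs; split=> //; exact: blip_sublevel_open bfm.
have G2 : G [set y | e / 2 < f m y].
  apply: xG; exists m => // n /= mn; apply: lt_le_trans (f_dec _ _ _ mn).
  by apply: le_lt_trans (fx_ n); rewrite lerDl sumr_ge0 // => j _; exact: blip_ge0 (bh _).
have [y [/= y1 y2]] := filter_ex (filterI G1 G2).
by have := lt_trans y1 y2; rewrite ltxx.
Qed.

End sigma_smooth.

(** * From functionals to measures *)

Section riesz.
Context {R : realType} {E : completeMetricType R}.
Variable L : (E -> R) -> R.
Hypothesis L_approx : forall c e : R, 0 < e ->
  exists mu : probability (borel E) R,
    forall f : E -> R, blip c f -> `|L f - \int[mu]_x f x| <= e.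
Hypothesis E_separable : separable E.

Definition minorant (U : set E) : set (E -> R) :=
  [set f | (exists c, blip c f) /\ forall x, f x <= \1_U x].

Definition inner_mass (U : set E) : R := sup [set L f | f in minorant U].

Let minorant0 U : minorant U (fun=> 0).
Proof. by split; [exists 0; exact: blip_cst|move=> x]. Qed.

Let minorant_lip_env n U : minorant U (lip_env n U).
Proof. by split; [exists n.+1%:R; exact: blip_lip_env|exact: lip_env_le_indic]. Qed.

Let minorant_L01 U f : minorant U f -> 0 <= L f <= 1.
Proof.
move=> [[c bf] fU]; rewrite (functional_ge0 L_approx bf) /=.
rewrite -(functional_cst L_approx ler01).
apply: (functional_le L_approx bf (blip_cst ler01 (lexx 1))) => x.
exact: le_trans (fU x) _.
Qed.

Lemma inner_mass_ub U f : minorant U f -> L f <= inner_mass U.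
Proof.
move=> Uf; apply: ub_le_sup; last by exists f.
by exists 1 => _ [g Ug <-]; have /andP[] := minorant_L01 Ug.
Qed.

Lemma inner_mass_lub U r : (forall f, minorant U f -> L f <= r) -> inner_mass U <= r.
Proof.
move=> Ur; apply: ge_sup; first by exists (L (fun=> 0)), (fun=> 0).
by move=> _ [f Uf <-]; exact: Ur.
Qed.

Lemma inner_mass_ge0 U : 0 <= inner_mass U.
Proof.
by apply: le_trans (inner_mass_ub (minorant0 U)); have /andP[] := minorant_L01 (minorant0 U).
Qed.

Lemma inner_mass_le1 U : inner_mass U <= 1.
Proof. by apply: inner_mass_lub => f /minorant_L01/andP[]. Qed.

Lemma inner_mass0 : inner_mass set0 = 0.
Proof.
apply/eqP; rewrite eq_le inner_mass_ge0 andbT; apply: inner_mass_lub => f [[c bf] f0].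
rewrite -(functional_cst L_approx (lexx 0)).
apply: (functional_le L_approx bf (blip_cst (lexx 0) (lexx 0))) => x.
by have := f0 x; rewrite indic0.
Qed.

Lemma inner_massT : inner_mass setT = 1.
Proof.
apply/eqP; rewrite eq_le inner_mass_le1 -{1}(functional_cst L_approx ler01).
apply: inner_mass_ub; split; first by exists 1; exact: blip_cst.
by move=> x; rewrite indicT.
Qed.

Lemma le_inner_mass U W : U `<=` W -> inner_mass U <= inner_mass W.
Proof.
move=> UW; apply: inner_mass_lub => f [bf fU]; apply: inner_mass_ub.
split=> // x; rewrite (le_trans (fU x)) // !indicE ler_nat.
have [/set_mem/UW Wx|//] := boolP (x \in U); by rewrite mem_set.
Qed.

(** Given [f <= 1_U] with [U] the union of the [U i], the excess of [f] over the
    sum of the first [n] envelopes, of slope [n.+1], decreases to 0: its image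
    under [L] is eventually negligible, and the rest is paid by the [U i]. *)
Lemma inner_mass_sigma_subadditive (U : nat -> set E) : (forall i, open (U i)) ->
  ((inner_mass (\bigcup_i U i))%:E <= \sum_(i <oo) (inner_mass (U i))%:E)%E.
Proof.
move=> oU; apply/lee_addgt0Pr => e e0.
have partial n : (\sum_(i < n) (inner_mass (U i))%:E <=
    \sum_(i <oo) (inner_mass (U i))%:E)%E.
  rewrite -(big_mkord xpredT (fun i => (inner_mass (U i))%:E)).
  by apply: nneseries_lim_ge => i _ _; rewrite lee_fin inner_mass_ge0.
suff : forall f, minorant (\bigcup_i U i) f ->
    exists n, L f <= \sum_(i < n) inner_mass (U i) + e.
  move=> Lf; have [->|] := eqVneq (\sum_(i <oo) (inner_mass (U i))%:E)%E +oo%E.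
    by rewrite leey.
  have s0 : (0 <= \sum_(i <oo) (inner_mass (U i))%:E)%E.
    by apply: nneseries_ge0 => i _ _; rewrite lee_fin inner_mass_ge0.
  move: partial s0; case: (\sum_(i <oo) _)%E => // s partial _ _.
  rewrite -EFinD lee_fin; apply: inner_mass_lub => f /Lf[n /le_trans]; apply.
  by rewrite lerD2r -lee_fin -sumEFin.
move=> f [[c bf] fU].
pose S n x := \sum_(i < n) lip_env n (U i) x.
have bS n : exists2 a, blip a (S n) & L (S n) = \sum_(i < n) L (lip_env n (U i)).
  apply: (functional_sum L_approx (F := fun i => lip_env n (U i))) => i.
  by exists n.+1%:R; exact: blip_lip_env.
have [n Ln] : exists n, L (fun x => Num.max (f x - S n x) 0) <= e.
  have [a a_dense] := dense_sequence E_separable.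
  apply: (functional_sigma_smooth a_dense L_approx) => //.
  - by move=> n; have [b bSn _] := bS n; exists (c + b); exact: blip_excess.
  - move=> m n x mn; suff : S m x <= S n x.
      by rewrite /Num.max; case: ifPn; case: ifPn; rewrite -?leNgt; lra.
    rewrite /S -(big_mkord xpredT (fun i => lip_env m (U i) x)).
    rewrite -(big_mkord xpredT (fun i => lip_env n (U i) x)) (big_cat_nat (leq0n m) mn) /=.
    rewrite ler_wpDr ?sumr_ge0 //; first by move=> i _; exact: blip_ge0 (blip_lip_env _ _).
    by apply: ler_sum => i _; exact: lip_env_nondecreasing.
  - move=> n x; rewrite ge_max ler01 andbT.
    have Sn0 : 0 <= S n x by apply: sumr_ge0 => i _; exact: blip_ge0 (blip_lip_env _ _).
    have : f x <= 1 by apply: le_trans (fU x) _.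
    by lra.
  - move=> x d d0; have [[i _ Uix]|nUx] := pselect ((\bigcup_i U i) x); last first.
      exists 0%N; rewrite gt_max d0 andbT /S big_ord0.
      by have := fU x; rewrite indicE memNset //=; lra.
    have [N Nx] := lip_env_eq1 (oU i) Uix.
    exists (maxn N i.+1); rewrite gt_max d0 andbT.
    have iN : (i < maxn N i.+1)%N by rewrite leq_max ltnSn orbT.
    have : 1 <= S (maxn N i.+1) x.
      rewrite -(Nx (maxn N i.+1)) ?leq_maxl // /S (bigD1 (Ordinal iN)) //=.
      rewrite lerDl sumr_ge0 // => j _; exact: blip_ge0 (blip_lip_env _ _).
    have : f x <= 1 by apply: le_trans (fU x) _.
    by lra.
exists n; have [b bSn LSn] := bS n.
have bexc := blip_excess bf bSn.
apply: le_trans (functional_le L_approx bf (blipD bSn bexc) _) _.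
  by move=> x; rewrite -lerBlDl le_max lexx.
rewrite (functionalD L_approx bSn bexc) LSn lerD //.
by apply: ler_sum => i _; exact: inner_mass_ub.
Qed.

Definition outer_mass (A : set E) : \bar R :=
  (inf [set inner_mass U | U in [set U | open U /\ A `<=` U]])%:E.

Let outer_mass_lb A : lbound [set inner_mass U | U in [set U | open U /\ A `<=` U]] 0.
Proof. by move=> _ [U _ <-]; exact: inner_mass_ge0. Qed.

Let outer_mass_neq0 A : [set inner_mass U | U in [set U | open U /\ A `<=` U]] !=set0.
Proof. by exists (inner_mass setT), setT => //; split => //; exact: openT. Qed.

Lemma outer_mass_le A U : open U -> A `<=` U -> (outer_mass A <= (inner_mass U)%:E)%E.
Proof.
by move=> oU AU; rewrite lee_fin; apply: ge_inf; [exists 0; exact: outer_mass_lb|exists U].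
Qed.

Lemma outer_mass_glb A r : (forall U, open U -> A `<=` U -> r <= inner_mass U) ->
  (r%:E <= outer_mass A)%E.
Proof. by move=> Ar; rewrite lee_fin; apply: lb_le_inf => // _ [U [oU AU] <-]; exact: Ar. Qed.

Lemma outer_mass_open U : open U -> outer_mass U = (inner_mass U)%:E.
Proof.
move=> oU; apply/eqP; rewrite eq_le outer_mass_le //=.
by apply: outer_mass_glb => W oW; exact: le_inner_mass.
Qed.

Let outer_mass_ge0 A : (0 <= outer_mass A)%E.
Proof. by apply: outer_mass_glb => U _ _; exact: inner_mass_ge0. Qed.

Let outer_mass0 : outer_mass set0 = 0%E.
Proof. by rewrite outer_mass_open ?inner_mass0 //; exact: open0. Qed.

Let le_outer_mass : {homo outer_mass : A B / A `<=` B >-> (A <= B)%E}.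
Proof.
by move=> A B AB; apply: outer_mass_glb => U oU BU; rewrite -lee_fin;
  apply: outer_mass_le => //; exact: subset_trans BU.
Qed.

Let outer_mass_sigma_subadditive : measure_extension.sigma_subadditive outer_mass.
Proof.
move=> F; apply/lee_addgt0Pr => e e0.
apply: le_trans (epsilon_trick _ _ (ltW e0)); last by move=> n; exact: outer_mass_ge0.
have en n : 0 < e / (2 ^ n.+1)%:R by rewrite divr_gt0 // ltr0n expn_gt0.
have /choice[U FU] n : exists U, [/\ open U, F n `<=` U &
    ((inner_mass U)%:E <= outer_mass (F n) + (e / (2 ^ n.+1)%:R)%:E)%E].
  have [_ [U [oU FU] <-] lt] := inf_adherent (en n)
    (conj (outer_mass_neq0 (F n)) (ex_intro _ 0 (@outer_mass_lb (F n)))).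
  by exists U; split => //; rewrite -EFinD lee_fin ltW.
have oU i : open (U i) by have [] := FU i.
apply: (@le_trans _ _ (inner_mass (\bigcup_i U i))%:E).
  apply: outer_mass_le; first exact: bigcup_open.
  by apply: subset_bigcup => i _; have [] := FU i.
apply: le_trans (inner_mass_sigma_subadditive oU) _.
apply: lee_nneseries; first by move=> i _ _; rewrite lee_fin inner_mass_ge0.
by move=> i _; have [] := FU i.
Qed.

HB.instance Definition _ := isOuterMeasure.Build R E outer_mass
  outer_mass0 outer_mass_ge0 le_outer_mass outer_mass_sigma_subadditive.

(** Let [W] be open and contain [A].  If [f <= 1_(W `&` U)] nearly realises the
    mass of [W `&` U], then [A] minus [U] lies in the open set of points of [W]
    where [f] is small, and the excess of [f] over that small level has a support
    disjoint from it: the two masses add up to at most that of [W]. *)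
Lemma open_caratheodory U : open U -> outer_mass.-caratheodory U.
Proof.
move=> oU; apply: le_caratheodory_measurable => A /=.
have finA B : outer_mass B \is a fin_num by [].
rewrite -(fineK (finA (A `&` U))) -(fineK (finA (A `&` ~` U))) -EFinD.
apply: outer_mass_glb => W oW AW.
have AU_le : fine (outer_mass (A `&` U)) <= inner_mass (W `&` U).
  rewrite -lee_fin fineK //; apply: outer_mass_le; first exact: openI.
  exact: setSI.
rewrite -lerBrDr; apply: le_trans AU_le _; apply: inner_mass_lub => f fWU.
apply/ler_addgt0Pr => e e0; have [[c bf] f1] := fWU.
rewrite -lerBlDr; set g_small := [set x | f x < e].
have oS : open (W `&` g_small) by apply: openI => //; exact: blip_sublevel_open bf.
have AU_small : fine (outer_mass (A `&` ~` U)) <= inner_mass (W `&` g_small).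
  rewrite -lee_fin fineK //; apply: outer_mass_le => // x [Ax nUx]; split; first exact: AW.
  rewrite /g_small /= (le_lt_trans (f1 x)) // indicE memNset //.
  by move=> [].
rewrite lerBrDr -lerBrDl; apply: le_trans AU_small _; apply: inner_mass_lub => g [[c' bg] g1].
have be := blip_cst (E:=E) (ltW e0) (lexx e).
have bexc := blip_excess bf be.
have Lf : L f <= L (fun x => Num.max (f x - e) 0) + e.
  rewrite -[X in _ + X](functional_cst L_approx (ltW e0)) -(functionalD L_approx bexc be).
  apply: (functional_le L_approx bf (blipD bexc be)) => x.
  by rewrite -lerBlDr le_max lexx.
suff : L (fun x => Num.max (f x - e) 0) + L g <= inner_mass W by lra.
rewrite -(functionalD L_approx bexc bg); apply: inner_mass_ub; split.
  by eexists; exact: (blipD bexc bg).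
move=> x; have := f1 x; have := g1 x; have := blip_ge0 x bg; have := blip_ge0 x bf.
rewrite !indicE !in_setI; have [Wx|nWx] := boolP (x \in W) => /=; last first.
  by rewrite /Num.max; case: ifPn; rewrite -?leNgt; lra.
have [fxe|nfxe] := boolP (x \in g_small).
  move/set_mem : fxe; rewrite /g_small/= => fxe _ g0 gx _.
  by rewrite max_r; lra.
move=> /= f0 g0 gx0 fU; have f1' : f x <= 1 by case: (x \in U) fU => /=; lra.
move: gx0 => /=; by rewrite /Num.max; case: ifPn; rewrite -?leNgt; lra.
Qed.

(** A distinct name on the Borel sets, so that the measure structure does not
    compete with the outer measure structure of [outer_mass]. *)
Definition riesz_measure : set (borel E) -> \bar R := outer_mass.

Let borel_caratheodory (A : set (borel E)) : measurable A -> outer_mass.-caratheodory A.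
Proof.
apply: smallest_sub; last exact: open_caratheodory.
exact: (@sigma_algebra_measurable _ (caratheodory_type outer_mass)).
Qed.

Let riesz_measure0 : riesz_measure set0 = 0%E. Proof. exact: outer_mass0. Qed.

Let riesz_measure_ge0 A : (0 <= riesz_measure A)%E. Proof. exact: outer_mass_ge0. Qed.

Let riesz_measure_sigma_additive : semi_sigma_additive riesz_measure.
Proof.
move=> F mF tF mUF; apply: (@caratheodory_measure_sigma_additive R E outer_mass) => //.
  by move=> i; exact: borel_caratheodory.
exact: borel_caratheodory.
Qed.

HB.instance Definition _ := isMeasure.Build _ (borel E) R riesz_measure
  riesz_measure0 riesz_measure_ge0 riesz_measure_sigma_additive.

Let riesz_measureT : riesz_measure setT = 1%E.
Proof. by rewrite /riesz_measure outer_mass_open ?inner_massT //; exact: openT. Qed.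

HB.instance Definition _ := Measure_isProbability.Build _ (borel E) R riesz_measure
  riesz_measureT.

Let pi : probability (borel E) R := riesz_measure.

Let pi_open U : open U -> pi U = (inner_mass U)%:E.
Proof. exact: outer_mass_open. Qed.

Let Rintegral_min_le c f (d : R) : 0 <= d -> blip c f ->
  \int[pi]_x Num.min (f x) d <= d * inner_mass [set x | 0 < f x].
Proof.
move=> d0 bf; have bm := blip_min d0 bf.
pose U : set (borel E) := [set x | 0 < f x].
have oU : open (U : set E) by exact: blip_superlevel_open bf.
have mU : measurable U by exact: sub_sigma_algebra.
rewrite -lee_fin (EFin_Rintegral_blip pi bm) EFinM -pi_open //.
have <- : (\int[pi]_x (\1_U x)%:E)%E = pi U by rewrite integral_indic // setIT.
have m1 : measurable_fun setT (fun x => (\1_U x : R)%:E).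
  by apply/measurable_EFinP; exact: measurable_indic.
rewrite -(ge0_integralZl_EFin _ measurableT) //.
apply: ge0_le_integral => //.
- by move=> x _; rewrite lee_fin (blip_ge0 x bm).
- by apply/measurable_EFinP; exact: blip_measurable bm.
- by apply: measurable_funeM.
- move=> x _; rewrite -EFinM lee_fin indicE.
  have [fx|] := boolP (x \in _); first by rewrite mulr1 ge_min lexx orbT.
  by rewrite notin_setE /= mulr0 ge_min => /negP; rewrite -leNgt => ->.
Qed.

(** [min(f, d)] dominates [d] times any minorant of the indicator of [f > d]. *)
Let inner_mass_le_strip c f (d : R) : 0 <= d -> blip c f ->
  d * inner_mass [set x | d < f x] <= L (fun x => Num.min (f x) d).
Proof.
move=> d0 bf; have [->|dn0] := eqVneq d 0.
  by rewrite mul0r; exact: (functional_ge0 L_approx (blip_min (lexx 0) bf)).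
have {dn0}dpos : 0 < d by rewrite lt_neqAle eq_sym dn0.
rewrite mulrC -ler_pdivlMr //; apply: inner_mass_lub => h [[c' bh] hU].
rewrite ler_pdivlMr // mulrC -(functionalZ L_approx d0 bh).
apply: (functional_le L_approx (blipZ d0 bh) (blip_min d0 bf)) => x.
have := hU x; have := blip_ge0 x bf; rewrite indicE le_min.
have [/set_mem /= fx|] := boolP (x \in _); first by rewrite /= => ? ?; apply/andP; split; nra.
by rewrite /= => _ ? ?; apply/andP; split; nra.
Qed.

(** Peeling off the lowest strip [min(f, d)]: the mass of the set where [f > d],
    which bounds the integral of the next strip, is in turn bounded by [L] of
    the strip just removed.  The masses telescope, up to the first one. *)
Let Rintegral_le_strips (d : R) N : 0 <= d -> forall c f, blip c f ->
  (forall x, f x <= N%:R * d) ->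
  \int[pi]_x f x <= L f + d * inner_mass [set x | 0 < f x].
Proof.
move=> d0; elim: N => [|N IH] c f bf fN.
  have f0 : f = (fun=> 0).
    by apply/funext => x; apply/eqP; rewrite eq_le (blip_ge0 x bf) -(mul0r d) fN.
  by rewrite f0 Rintegral_cst_probability (functional_cst L_approx) // add0r
    mulr_ge0 // inner_mass_ge0.
have bm := blip_min d0 bf; have be := blip_excess bf (blip_cst d0 (lexx d)).
have split_f : f = (fun x => Num.max (f x - d) 0 + Num.min (f x) d).
  by apply/funext => x; rewrite /Num.max /Num.min; case: ifPn; case: ifPn; rewrite -?leNgt; lra.
have excess : \int[pi]_x Num.max (f x - d) 0 <=
    L (fun x => Num.max (f x - d) 0) + d * inner_mass [set x | d < f x].
  have -> : [set x | d < f x] = [set x | 0 < Num.max (f x - d) 0].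
    by apply/seteqP; split => x /=; rewrite lt_max ltxx orbF subr_gt0.
  apply: (IH _ _ be) => x; rewrite ge_max mulr_ge0 // andbT.
  by have := fN x; rewrite -natr1 mulrDl; lra.
rewrite [X in \int[pi]_x X x <= L X + _]split_f.
rewrite (RintegralD_blip pi be bm) (functionalD L_approx be bm).
have := inner_mass_le_strip d0 bf; have := Rintegral_min_le d0 bf.
by lra.
Qed.

Let Rintegral_le_functional c f : blip c f -> \int[pi]_x f x <= L f.
Proof.
move=> bf; apply/ler_addgt0Pr => d d0.
have c0 := blip_bound_ge0 point bf.
have fN x : f x <= (Num.truncn (c / d)).+1%:R * d.
  by rewrite (le_trans (blip_le x bf)) // -ler_pdivrMr // ltW // truncnS_gt.
apply: le_trans (Rintegral_le_strips (ltW d0) bf fN) _.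
by rewrite lerD2l ger_pMr // inner_mass_le1.
Qed.

(** The strips give one inequality as [d] tends to 0; applied to [c - f], the
    same inequality gives the converse. *)
Theorem functional_representation : exists mu : probability (borel E) R,
  forall c f, blip c f -> \int[mu]_x f x = L f.
Proof.
exists pi => c f bf; apply/eqP; rewrite eq_le (Rintegral_le_functional bf) /=.
have bo := blip_opp bf; have := Rintegral_le_functional bo.
have cE : (fun x => f x + (c - f x)) = (fun=> c) by apply/funext => x; ring.
have c0 := blip_bound_ge0 point bf.
have := functionalD L_approx bf bo; rewrite cE (functional_cst L_approx c0).
have := RintegralD_blip pi bf bo; rewrite cE Rintegral_cst_probability.
by lra.
Qed.

End riesz.

(** Probabilities on a complete separable metric space are complete for the
    bounded Lipschitz distance. *)
Theorem bounded_lipschitz_complete (R : realType) (E : completeMetricType R)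
    (mu : nat -> probability (borel E) R) : separable E ->
  (forall e : R, 0 < e -> exists N, forall j k, (N <= j)%N -> (N <= k)%N ->
    forall f, blip 1 f -> \int[mu j]_x f x <= \int[mu k]_x f x + e) ->
  exists pi : probability (borel E) R, forall f, blip 1 f ->
    \int[mu k]_x f x @[k --> \oo] --> \int[pi]_x f x.
Proof.
move=> sepE mu_cauchy.
have mu_cauchyZ (c e : R) : 0 < e -> exists N, forall j k, (N <= j)%N -> (N <= k)%N ->
    forall f, blip c f -> \int[mu j]_x f x <= \int[mu k]_x f x + e.
  move=> e0; have [c0|c_le0] := ltP 0 c; last first.
    exists 0%N => j k _ _ f bf.
    have f0 : f = (fun=> 0).
      by apply/funext => x; apply/eqP; rewrite eq_le (blip_ge0 x bf) (le_trans (blip_le x bf)).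
    by rewrite f0 !Rintegral_cst_probability add0r ltW.
  have [N muN] := mu_cauchy _ (divr_gt0 e0 c0); exists N => j k Nj Nk f bf.
  have bf1 : blip 1 (fun x => c^-1 * f x).
    by rewrite -[X in blip X](mulVf (lt0r_neq0 c0)); apply: blipZ => //; rewrite invr_ge0 ltW.
  have := muN j k Nj Nk _ bf1; rewrite !(RintegralZ_blip _ _ bf).
  by rewrite ler_pdivrMl // mulrDr mulrA mulfV ?lt0r_neq0 // mul1r mulrCA mulfV ?lt0r_neq0 // mulr1.
pose L f := lim (\int[mu k]_x f x @[k --> \oo]).
have L_cvg c f : blip c f -> \int[mu k]_x f x @[k --> \oo] --> L f.
  move=> bf; apply: cauchy_cvg; apply: cauchy_exP => e e0.
  have [N muN] := mu_cauchyZ c _ (divr_gt0 e0 (ltr0Sn R 1)).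
  exists (\int[mu N]_x f x); exists N => // k /= Nk.
  have := muN _ _ Nk (leqnn N) f bf; have := muN _ _ (leqnn N) Nk f bf.
  by rewrite /ball /= ltr_norml; lra.
have [|pi piL] := @functional_representation R E L _ sepE.
  move=> c e e0; have [N muN] := mu_cauchyZ c e e0; exists (mu N) => f bf.
  have cf : cvg (\int[mu k]_x f x @[k --> \oo]) by apply/cvg_ex; exists (L f); exact: (L_cvg c).
  have lb : \int[mu N]_x f x - e <= L f.
    by apply: limr_ge => //; exists N => // k /= Nk; rewrite lerBlDr muN.
  have ub : L f <= \int[mu N]_x f x + e.
    by apply: limr_le => //; exists N => // k /= Nk; rewrite muN.
  by rewrite ler_norml; lra.
by exists pi => f bf; rewrite (piL _ _ bf); exact: (L_cvg 1).
Qed.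

(** * Concave functions on the half-line *)

Section concave.
Context {R : realType} (psi : R -> R).
Hypothesis psi_concave : concave_function `[0%R, +oo[ psi.
Hypothesis psi_ge0 : forall v : R, 0 <= v -> 0 <= psi v.
Hypothesis psi_lim : psi v @[v --> +oo] --> +oo.

(** The convexity hypothesis, with its barycentres written out. *)
Let concave_le (x y t : R) : 0 <= x -> 0 <= y -> 0 <= t <= 1 ->
  t * psi x + (1 - t) * psi y <= psi (t * x + (1 - t) * y).
Proof.
move=> x0 y0 t01.
have := @psi_concave (Itv01 (proj1 (andP t01)) (proj2 (andP t01))) x y.
rewrite !inE /= !in_itv /= !andbT => /(_ x0 y0).
rewrite !convRE /= /unstable.onem; lra.
Qed.

(** A concave function that tends to infinity is nondecreasing: [y] lies
    between [x] and some [z] where the value is at least [psi x]. *)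
Lemma concave_nondecreasing x y : 0 <= x -> x <= y -> psi x <= psi y.
Proof.
move=> x0 xy.
have [M [_ psiM]] := (cvgryPge psi).1 psi_lim (psi x).
pose z := Num.max (M + 1) (y + 1).
have zy : y < z by rewrite lt_max; apply/orP; right; lra.
have psiz : psi x <= psi z by apply: psiM; rewrite lt_max; apply/orP; left; lra.
have zx : 0 < z - x by lra.
pose t := (z - y) / (z - x).
have t01 : 0 <= t <= 1.
  by rewrite divr_ge0 ?ler_pdivrMr //=; lra.
have yE : t * x + (1 - t) * z = y by rewrite /t; field; lra.
have := concave_le x0 (_ : 0 <= z) t01; rewrite yE => /(_ ltac:(lra)).
by have /andP[] := t01; nra.
Qed.

(** Below [r] this is concavity on [[0, r]] with [psi 0 >= 0], and beyond [r] it
    is monotonicity. *)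
Lemma concave_min_le v r : 0 <= v -> 0 < r -> 0 < psi r ->
  Num.min 1 (v / r) <= psi v / psi r.
Proof.
move=> v0 r0 psir; rewrite ler_pdivlMr //; have [rv|vr] := leP r v.
  have := concave_nondecreasing (ltW r0) rv; rewrite min_l ?mul1r //.
  by rewrite ler_pdivlMr // mul1r.
have t01 : 0 <= v / r <= 1 by rewrite divr_ge0 ?ler_pdivrMr ?(ltW r0) // mul1r ltW.
rewrite min_r; last by have /andP[] := t01.
have := concave_le (ltW r0) (lexx 0) t01; rewrite mulr0 addr0 divfK ?gt_eqF //.
apply: le_trans; rewrite lerDl mulr_ge0 ?psi_ge0 //.
by have /andP[] := t01; lra.
Qed.

Lemma concave_comp_measurable d (T : measurableType d) (V : T -> R) :
  (forall z, 0 <= V z) -> measurable_fun setT V -> measurable_fun setT (psi \o V).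
Proof.
move=> V0 mV.
(* psi is arbitrary on negative reals: make it monotone on the whole line *)
pose phi v := psi (Num.max v 0).
have -> : psi \o V = phi \o V by apply/funext => z; rewrite /phi /= max_l.
apply: measurableT_comp => //.
apply: nondecreasing_measurable => // x y xy.
apply: concave_nondecreasing; first by rewrite le_max lexx orbT.
by rewrite ge_max !le_max xy lexx orbT.
Qed.

End concave.

Local Open Scope ereal_scope.

(** * Iterated kernels *)

Section kernel_action.
Context d (X : measurableType d) (R : realType).
Implicit Types (K : R.-spker X ~> X) (f g : X -> \bar R).

Lemma integral_mkcomp_noparam d1 d2 d3 (X1 : measurableType d1)
    (X2 : measurableType d2) (X3 : measurableType d3)
    (K1 : R.-spker X1 ~> X2) (K2 : R.-spker X2 ~> X3) (f : X3 -> \bar R) x :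
  (forall z, 0 <= f z) -> measurable_fun setT f ->
  \int[mkcomp_noparam K1 K2 x]_z f z = \int[K1 x]_y \int[K2 y]_z f z.
Proof.
(* composition is the parameterized one with a kernel that ignores its parameter *)
by move=> f0 mf; exact: (integral_kcomp K1 (kernel.kernel_snd K2)).
Qed.

Lemma kapp_measurable K f : (forall z, 0 <= f z) -> measurable_fun setT f ->
  measurable_fun setT (kapp K f).
Proof.
by move=> f0 mf; apply: measurable_fun_integral_kernel => // U mU; exact: measurable_kernel.
Qed.

Lemma kapp_ge0 (K : X -> {measure set X -> \bar R}) f x : (forall z, 0 <= f z) -> 0 <= kapp K f x.
Proof. by move=> f0; apply: integral_ge0. Qed.

Lemma kapp_kiter0 K f x : measurable_fun setT f -> kapp (kiter K 0) f x = f x.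
Proof. by move=> mf; rewrite /kapp /= integral_dirac // diracT mul1e. Qed.

Lemma kapp_kiterS K n f x : (forall z, 0 <= f z) -> measurable_fun setT f ->
  kapp (kiter K n.+1) f x = kapp K (kapp (kiter K n) f) x.
Proof. exact: integral_mkcomp_noparam. Qed.

Lemma kapp_kiter1 K f x : (forall z, 0 <= f z) -> measurable_fun setT f ->
  kapp (kiter K 1) f x = kapp K f x.
Proof.
move=> f0 mf; rewrite kapp_kiterS //; congr (kapp K _ x).
by apply/funext => y; exact: kapp_kiter0.
Qed.

Lemma kapp_kiterD K m n f x : (forall z, 0 <= f z) -> measurable_fun setT f ->
  kapp (kiter K (m + n)) f x = kapp (kiter K m) (kapp (kiter K n) f) x.
Proof.
move=> f0 mf; have g0 z : 0 <= kapp (kiter K n) f z by exact: kapp_ge0.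
have mg : measurable_fun setT (kapp (kiter K n) f) by exact: kapp_measurable.
elim: m x => [|m IH] x; first by rewrite add0n kapp_kiter0.
by rewrite addSn !kapp_kiterS //; apply: eq_integral => y _; exact: IH.
Qed.

Lemma kiter_setT (P : R.-pker X ~> X) n x : kiter P n x setT = 1.
Proof.
elim: n x => [|n IH] x; first exact: diracT.
rewrite /= /mkcomp_noparam /= /kcomp_noparam.
under eq_integral do rewrite IH.
by rewrite integral_cst // mul1e prob_kernel.
Qed.

End kernel_action.

(** [kiter] is typed as a subprobability kernel; here its values carry the
    probability structure that [kiter_setT] justifies. *)
Section kiter_prob.
Context d (X : measurableType d) (R : realType) (P : R.-pker X ~> X) (n : nat) (x : X).
Definition kiter_prob : set X -> \bar R := kiter P n x.
HB.instance Definition _ := Measure.on kiter_prob.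
HB.instance Definition _ := Measure_isProbability.Build _ _ _ kiter_prob (kiter_setT P n x).
End kiter_prob.

Section affine.
Context d (X : measurableType d) (R : realType).

Lemma integral_affine_le (mu : {measure set X -> \bar R}) (f g h : X -> R) (a c r v : R) :
  mu setT <= 1 -> (0 <= a)%R -> (0 <= c)%R ->
  (forall z, 0 <= f z)%R -> (forall z, 0 <= g z)%R -> (forall z, 0 <= h z)%R ->
  measurable_fun setT f -> measurable_fun setT g -> measurable_fun setT h ->
  (forall z, f z <= a * g z + h z + c)%R ->
  \int[mu]_z (g z)%:E <= r%:E -> \int[mu]_z (h z)%:E <= v%:E ->
  \int[mu]_z (f z)%:E <= (a * r + v + c)%:E.
Proof.
move=> mu1 a0 c0 f0 g0 h0 /measurable_EFinP mf /measurable_EFinP mg /measurable_EFinP mh fle gr hv.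
have mag : measurable_fun setT (fun z => a%:E * (g z)%:E) by exact: measurable_funeM.
have magh : measurable_fun setT (fun z => a%:E * (g z)%:E + (h z)%:E) by exact: emeasurable_funD.
have ag0 z : 0 <= a%:E * (g z)%:E by rewrite mule_ge0 ?lee_fin.
apply: (@le_trans _ _ (\int[mu]_z (a%:E * (g z)%:E + (h z)%:E + c%:E))).
  apply: ge0_le_integral => //.
  - by move=> z _; rewrite lee_fin.
  - by apply: emeasurable_funD.
  - by move=> z _; rewrite -EFinM -!EFinD lee_fin.
have agh0 z : 0 <= a%:E * (g z)%:E + (h z)%:E by rewrite adde_ge0 // lee_fin.
rewrite ge0_integralD // ge0_integralD //; last by move=> z _; rewrite lee_fin.
rewrite ge0_integralZl_EFin //; last by move=> z _; rewrite lee_fin.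
rewrite integral_cst // !EFinD EFinM leeD //.
  by rewrite leeD // lee_wpmul2l // lee_fin.
by rewrite -[leRHS]mule1 lee_wpmul2l // lee_fin.
Qed.
End affine.

(** * Decay of the coupled distance under the drift condition *)

Section drift_contraction.
Context d (X : measurableType d) (R : realType) (Q : R.-pker X ~> X).
Variables (D V : X -> R) (Delta : set X) (l : nat) (b B delta : R).
Hypotheses (mD : measurable_fun setT D) (mV : measurable_fun setT V).
Hypotheses (D0 : forall z, (0 <= D z)%R) (D1 : forall z, (D z <= 1)%R).
Hypothesis V0 : forall z, (0 <= V z)%R.
Hypothesis l_gt0 : (0 < l)%N.
Hypotheses (delta0 : (0 <= delta)%R) (delta1 : (delta <= 1)%R).
Hypothesis Q_nonexpansive : forall z, kapp Q (EFin \o D) z <= (D z)%:E.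
Hypothesis Q_contract : forall z, Delta z ->
  kapp (kiter Q l) (EFin \o D) z <= (delta * D z)%:E.
Hypothesis Q_drift : forall z,
  kapp Q (EFin \o V) z <= (V z - 1 + b * \1_Delta z)%:E.
Hypothesis QV_bounded : forall z, Delta z ->
  kapp (kiter Q l.-1) (EFin \o V) z <= B%:E.

Let mED : measurable_fun setT (EFin \o D). Proof. exact/measurable_EFinP. Qed.
Let mEV : measurable_fun setT (EFin \o V). Proof. exact/measurable_EFinP. Qed.
Let ED0 z : 0 <= (EFin \o D) z. Proof. by rewrite lee_fin. Qed.
Let EV0 z : 0 <= (EFin \o V) z. Proof. by rewrite lee_fin. Qed.

Lemma kapp_kiter_le n z : kapp (kiter Q n) (EFin \o D) z <= (D z)%:E.
Proof.
elim: n z => [|n IH] z; first by rewrite kapp_kiter0.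
rewrite kapp_kiterS // (le_trans _ (Q_nonexpansive z)) //.
apply: ge0_le_integral => //; first by move=> y _; exact: kapp_ge0.
exact: kapp_measurable.
Qed.

Let u n z := fine (kapp (kiter Q n) (EFin \o D) z).

Let uE n z : (u n z)%:E = kapp (kiter Q n) (EFin \o D) z.
Proof.
rewrite fineK // ge0_fin_numE; last exact: kapp_ge0.
exact: le_lt_trans (kapp_kiter_le n z) (ltry _).
Qed.

Let u_ge0 n z : (0 <= u n z)%R.
Proof. by rewrite -lee_fin uE kapp_ge0. Qed.

Let u_le n z : (u n z <= D z)%R.
Proof. by rewrite -lee_fin uE kapp_kiter_le. Qed.

Let mu_ n : measurable_fun setT (u n).
Proof.
apply/measurable_EFinP; rewrite (_ : EFin \o u n = kapp (kiter Q n) (EFin \o D)).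
  exact: kapp_measurable.
by apply/funext => z; rewrite -uE.
Qed.

Let uS m n z : (u (m + n) z)%:E = \int[kiter Q m z]_w (u n w)%:E.
Proof.
rewrite uE kapp_kiterD //; apply: eq_integral => w _; by rewrite -uE.
Qed.

Let QlV z : Delta z -> kapp (kiter Q l) (EFin \o V) z <= (B + `|b|)%:E.
Proof.
move=> Dz; rewrite -(prednK l_gt0) -addn1 kapp_kiterD //.
have kV w : kapp (kiter Q 1) (EFin \o V) w <= (V w + `|b|)%:E.
  rewrite kapp_kiter1 // (le_trans (Q_drift w)) // lee_fin indicE.
  have := ler_norm b; have := normr_ge0 b; case: (w \in Delta) => /=; lra.
apply: (@le_trans _ _ (\int[kiter Q l.-1 z]_w ((V w)%:E + `|b|%:E))).
  apply: ge0_le_integral => //.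
  - by move=> y _; exact: kapp_ge0.
  - exact: kapp_measurable.
  - exact: emeasurable_funD.
rewrite ge0_integralD //; last by move=> y _; exact: EV0.
rewrite integral_cst // EFinD leeD //; first exact: QV_bounded.
by rewrite kiter_setT mule1.
Qed.

Let c : R := (B + `|b| + l%:R)%R.

(** The bound at time [n] is affine in [D] and [V], hence can be averaged over
    the first [k] steps; it is used with [k = 1] off [Delta] and [k = l] on it. *)
Let affine m n z k (v r : R) : (0 <= m%:R * c)%R ->
  (forall w, n%:R * u n w <= n%:R * delta ^+ m * D w + V w + c * m%:R)%R ->
  kapp (kiter Q k) (EFin \o D) z <= r%:E ->
  kapp (kiter Q k) (EFin \o V) z <= v%:E ->
  (n%:R * u (k + n) z <= n%:R * delta ^+ m * r + v + c * m%:R)%R.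
Proof.
move=> cm0 IH Dr Vv; rewrite -lee_fin EFinM uS -ge0_integralZl_EFin //; last 2 first.
- by move=> y _; rewrite lee_fin.
- exact/measurable_EFinP.
apply: (integral_affine_le (f := fun w => (n%:R * u n w)%R) (g := D) (h := V)) => //.
- by rewrite kiter_setT.
- by rewrite mulr_ge0 // exprn_ge0.
- by rewrite mulrC.
- by move=> w; rewrite mulr_ge0.
- exact: measurable_funM.
Qed.

Hypothesis B0 : (0 <= B)%R.

Let drift_decay_fine m n z :
  (n%:R * u n z <= n%:R * delta ^+ m * D z + V z + c * m%:R)%R.
Proof.
have c0 : (0 <= c)%R by rewrite !addr_ge0.
elim: m n z => [|m IHm] n z.
  rewrite expr0 mulr0 addr0 mulr1 ler_wpDr // ler_wpM2l //; exact: u_le.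
elim: n z => [|n IHn] z.
  by rewrite !mul0r add0r addr_ge0 // mulr_ge0.
have cm k : (0 <= k%:R * c)%R by rewrite mulr_ge0.
have u1 k : (u k z <= 1)%R by exact: le_trans (u_le k z) (D1 z).
have dm k : (0 <= delta ^+ k <= 1)%R by rewrite exprn_ge0 // exprn_ile1.
have cS k : (c * k.+1%:R = c * k%:R + c)%R by rewrite -natr1 mulrDr mulr1.
have [Dz|nDz] := pselect (Delta z).
  (* fewer than l steps remain: n u <= n is already at most c *)
  have [ln|nl] := leqP l n.+1; last first.
    have n1l : (n.+1%:R <= l%:R :> R)%R by rewrite ler_nat ltnW.
    have : (n.+1%:R * u n.+1 z <= n.+1%:R)%R by rewrite ler_piMr.
    have : (0 <= n.+1%:R * delta ^+ m.+1 * D z)%R.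
      by rewrite !mulr_ge0 //; have /andP[] := dm m.+1.
    have := V0 z; have := cm m; rewrite cS [(m%:R * c)%R]mulrC.
    have : (l%:R <= c)%R by rewrite lerDr addr_ge0.
    by lra.
  have := affine (cm m) (IHm (n.+1 - l)%N) (Q_contract Dz) (QlV Dz).
  rewrite subnKC // natrB // cS.
  have -> : ((n.+1%:R - l%:R) * delta ^+ m * (delta * D z) =
      (n.+1%:R - l%:R) * (delta ^+ m.+1 * D z))%R.
    by rewrite exprSr; ring.
  rewrite -[(n.+1%:R * delta ^+ m.+1 * D z)%R]mulrA.
  have l0 : (0 <= l%:R :> R)%R by [].
  have q0 : (0 <= delta ^+ m.+1 * D z)%R by rewrite mulr_ge0 // exprn_ge0.
  have lu : (l%:R * u n.+1 z <= l%:R)%R by rewrite ler_piMr.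
  have lq : (0 <= l%:R * (delta ^+ m.+1 * D z))%R by rewrite mulr_ge0.
  have cE : (c = B + `|b| + l%:R)%R by [].
  by have := V0 z; rewrite !mulrBl; move: cE; move: c => c' ->; lra.
(* off Delta, the decrease of V by 1 pays for passing from n to n.+1 *)
have QD : kapp (kiter Q 1) (EFin \o D) z <= (D z)%:E.
  by rewrite kapp_kiter1.
have QV : kapp (kiter Q 1) (EFin \o V) z <= (V z - 1)%:E.
  by have := Q_drift z; rewrite kapp_kiter1 // indicE memNset // mulr0 addr0.
have := affine (cm m.+1) IHn QD QV; rewrite add1n -[(n.+1%:R)%R]natr1.
have /andP[dm0 _] := dm m.+1; have := u1 n.+1; have := D0 z.
by move: (delta ^+ m.+1)%R dm0 => q; nra.
Qed.

(** For any [m], the mean of [D] after [n] steps is at most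
    [delta ^+ m + O((V + m) / n)]: the cost in [n] of [m] contractions is paid
    once and for all by [V] and a constant per contraction. *)
Theorem drift_decay m n z : n%:R%:E * kapp (kiter Q n) (EFin \o D) z <=
  (n%:R * delta ^+ m * D z + V z + (B + `|b| + l%:R) * m%:R)%:E.
Proof. by rewrite -uE -EFinM lee_fin; exact: drift_decay_fine. Qed.

End drift_contraction.

(** * Couplings on a metric space *)

Section borel_product.
Context {R : realType} {E : completeMetricType R}.

(** The sigma-algebra on [E * E] is generated by the product topology, so
    continuity suffices here and in the next three lemmas. *)
Lemma mdist_measurable :
  measurable_fun [set: borel (E * E)] (fun z => mdist z.1 z.2 : R).
Proof.
apply: superlevel_measurable => r; rewrite openE => -[x y] /= rxy; apply/nbhs_ballP.
exists ((mdist x y - r) / 2)%R => /=; first by rewrite divr_gt0 // subr_gt0.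
move=> [x' y'] [/=]; rewrite !ballEmdist /= => xx' yy'.
have := metric_triangle x x' y; have := metric_triangle x' y' y.
by rewrite (metric_sym y' y); lra.
Qed.

Lemma borel_measurable_fst :
  measurable_fun [set: borel (E * E)] (fst : borel (E * E) -> borel E).
Proof.
apply: preimage_measurable => U oU.
by apply: (continuousP (fst : E * E -> E)).1 oU => z; exact: cvg_fst.
Qed.

Lemma borel_measurable_snd :
  measurable_fun [set: borel (E * E)] (snd : borel (E * E) -> borel E).
Proof.
apply: preimage_measurable => U oU.
by apply: (continuousP (snd : E * E -> E)).1 oU => z; exact: cvg_snd.
Qed.

Lemma borel_measurable_pair (x : E) :
  measurable_fun [set: borel E] ((fun y => (x, y)) : borel E -> borel (E * E)).
Proof.
apply: preimage_measurable => U oU.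
apply: (continuousP (fun y : E => (x, y))).1 oU => y.
by apply: cvg_pair => //=; exact: cvg_cst.
Qed.

(** Envelopes of open sets are test functions up to a scalar and increase to
    the indicators, and open sets form a pi-system. *)
Lemma blip_measure_unique (mu nu : probability (borel E) R) :
  (forall f, blip 1 f -> (\int[mu]_x f x = \int[nu]_x f x)%R) ->
  forall A : set (borel E), measurable A -> mu A = nu A.
Proof.
move=> munu A mA.
apply: (@measure_unique _ R (borel E) (@open E) (fun=> setT) _ _ _ _ mu nu _ _ A mA) => //.
- by move=> ? ?; exact: openI.
- by move=> _; exact: openT.
- by apply/seteqP; split => // x _; exists 0%N.
- move=> U oU.
  have mU : measurable (U : set (borel E)) by exact: sub_sigma_algebra.
  have lim (m : probability (borel E) R) :
      \int[m]_x (lip_env n U x)%:E @[n --> \oo] --> m U.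
    have -> : m U = \int[m]_x (\1_(U : set (borel E)) x)%:E by rewrite integral_indic // setIT.
    apply: bounded_convergence.
    + by move=> n; apply/measurable_EFinP; exact: blip_measurable (blip_lip_env _ _).
    + by apply/measurable_EFinP; exact: measurable_indic.
    + move=> n x; rewrite !lee_fin (blip_ge0 x (blip_lip_env _ _)) /=.
      exact: le_trans (lip_env_le_indic _ _ _) _.
    + move=> x; have [Ux|nUx] := pselect (U x).
        have [N envN] := lip_env_eq1 oU Ux.
        apply: cvg_near_cst; exists N => // n /= Nn.
        by rewrite envN // indicE mem_set.
      apply: cvg_near_cst; apply: nearW => n; rewrite indicE memNset //=.
      congr EFin; apply/eqP; rewrite eq_le (blip_ge0 x (blip_lip_env _ _)) andbT.
      by have := lip_env_le_indic n U x; rewrite indicE memNset.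
  apply: cvg_unique (lim mu) _ => //.
  rewrite (_ : (fun n => _) = (fun n => \int[nu]_x (lip_env n U x)%:E)).
    exact: lim.
  apply/funext => n; have be := blip_lip_env n U.
  rewrite -!(EFin_Rintegral_blip _ be); congr EFin.
  have n1 : (n.+1%:R != 0 :> R)%R by [].
  have b1 : blip 1 (fun x => n.+1%:R^-1 * lip_env n U x)%R.
    by rewrite -[X in blip X](mulVf n1); exact: blipZ.
  have := munu _ b1; rewrite !(RintegralZ_blip _ _ be).
  by apply: mulfI; rewrite invr_neq0.
- by move=> _; rewrite (le_lt_trans (probability_le1 _ _)) // ltry.
Qed.

End borel_product.

(** The real number [P^n f(x)], for [f] integrable. *)
Definition kmean d (X : measurableType d) (R : realType) (P : R.-pker X ~> X)
  (n : nat) (f : X -> R) (x : X) : R := (\int[kiter_prob P n x]_y f y)%R.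

Definition coupling_cost (R : realType) (E : completeMetricType R)
    (Q : R.-pker borel (E * E) ~> borel (E * E)) (n : nat) (x y : E) : \bar R :=
  kapp (kiter Q n) (fun z => (mdist z.1 z.2)%:E) (x, y).

Lemma EFin_kmean (R : realType) (E : completeMetricType R)
    (P : R.-pker borel E ~> borel E) n c (f : E -> R) x :
  blip c f -> (kmean P n f x)%:E = kapp (kiter P n) (EFin \o f) x.
Proof. by move=> bf; rewrite (EFin_Rintegral_blip _ bf). Qed.

Section coupling.
Context {R : realType} {E : completeMetricType R}.
Variables (P : R.-pker borel E ~> borel E) (Q : R.-pker borel (E * E) ~> borel (E * E)).
Hypothesis PQ : coupling_kernel P Q.

Lemma coupling_kiter n (x y : E) (g : borel E -> \bar R) :
  (forall z, 0 <= g z) -> measurable_fun setT g ->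
  kapp (kiter Q n) (g \o fst) (x, y) = kapp (kiter P n) g x /\
  kapp (kiter Q n) (g \o snd) (x, y) = kapp (kiter P n) g y.
Proof.
move=> g0 mg.
have mgf : measurable_fun [set: borel (E * E)] (g \o fst).
  exact: measurableT_comp mg borel_measurable_fst.
have mgs : measurable_fun [set: borel (E * E)] (g \o snd).
  exact: measurableT_comp mg borel_measurable_snd.
have gf0 (z : borel (E * E)) : 0 <= (g \o fst) z by exact: g0.
have gs0 (z : borel (E * E)) : 0 <= (g \o snd) z by exact: g0.
elim: n x y => [|n IH] x y; first by rewrite !kapp_kiter0.
have mh : measurable_fun setT (kapp (kiter P n) g) by exact: kapp_measurable.
have h0 z : 0 <= kapp (kiter P n) g z by exact: kapp_ge0.
rewrite !kapp_kiterS //; split.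
- transitivity (kapp Q (kapp (kiter P n) g \o fst) (x, y)).
    by apply: eq_integral => -[x' y'] _; have [] := IH x' y'.
  rewrite /kapp -(ge0_integral_pushforward borel_measurable_fst (Q (x, y)) measurableT) //.
    apply: eq_measure_integral; first exact: borel_measurable_fst.
    by move=> ? A mA _; have [QP _] := PQ x y mA.
  by move=> z _; exact: h0.
- transitivity (kapp Q (kapp (kiter P n) g \o snd) (x, y)).
    by apply: eq_integral => -[x' y'] _; have [] := IH x' y'.
  rewrite /kapp -(ge0_integral_pushforward borel_measurable_snd (Q (x, y)) measurableT) //.
    apply: eq_measure_integral; first exact: borel_measurable_snd.
    by move=> ? A mA _; have [_ QP] := PQ x y mA.
  by move=> z _; exact: h0.
Qed.

(** Both means are integrals under the coupled chain, of [f] at the first and at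
    the second coordinate, and these values differ by at most the distance. *)
Lemma coupling_cost_le n f x y : blip 1 f ->
  (`|kmean P n f x - kmean P n f y|)%:E <= coupling_cost Q n x y.
Proof.
move=> bf; have mf := blip_measurable bf.
have mEf : measurable_fun [set: borel E] (EFin \o f) by exact/measurable_EFinP.
have f0 z : 0 <= (EFin \o f) z by rewrite lee_fin (blip_ge0 z bf).
have mD : measurable_fun [set: borel (E * E)] (fun z => (mdist z.1 z.2)%:E : \bar R).
  by apply/measurable_EFinP; exact: mdist_measurable.
have D0 (z : E * E) : 0 <= (mdist z.1 z.2)%:E by rewrite lee_fin mdist_ge0.
have [Qx Qy] := coupling_kiter n x y f0 mEf.
have f01 (z : borel (E * E)) : 0 <= (EFin \o f) z.1 by exact: f0.
have f02 (z : borel (E * E)) : 0 <= (EFin \o f) z.2 by exact: f0.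
have mf1 : measurable_fun [set: borel (E * E)] (fun z => (f z.1)%:E : \bar R).
  exact: measurableT_comp mEf borel_measurable_fst.
have mf2 : measurable_fun [set: borel (E * E)] (fun z => (f z.2)%:E : \bar R).
  exact: measurableT_comp mEf borel_measurable_snd.
have le1 : (kmean P n f x)%:E <= (kmean P n f y)%:E + coupling_cost Q n x y.
  rewrite !(EFin_kmean P n _ bf) -Qx -Qy /coupling_cost /kapp -ge0_integralD //;
    last by move=> z _; exact: f02.
  apply: ge0_le_integral => //; [by move=> z _; exact: f01|exact: emeasurable_funD|].
  move=> z _; rewrite -EFinD lee_fin.
  by have := blip_lipschitz z.1 z.2 bf; rewrite mul1r.
have le2 : (kmean P n f y)%:E <= (kmean P n f x)%:E + coupling_cost Q n x y.
  rewrite !(EFin_kmean P n _ bf) -Qx -Qy /coupling_cost /kapp -ge0_integralD //;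
    last by move=> z _; exact: f01.
  apply: ge0_le_integral => //; [by move=> z _; exact: f02|exact: emeasurable_funD|].
  move=> z _; rewrite -EFinD lee_fin.
  by have := blip_lipschitz z.2 z.1 bf; rewrite mul1r metric_sym.
move: le1 le2; case: (coupling_cost Q n x y) => [r| |]; last by [].
  by rewrite -!EFinD !lee_fin ler_norml; lra.
by move=> _ _; rewrite leey.
Qed.

End coupling.

(** * Invariant probabilities *)

Lemma increasing_ge_id (n : nat -> nat) k :
  {homo n : i j / (i < j)%N} -> (k <= n k)%N.
Proof. by move=> n_incr; elim: k => // k IH; rewrite (leq_ltn_trans IH) // n_incr. Qed.

Section pushforward_by_kernel.
Context d (X : measurableType d) (R : realType) (P : R.-pker X ~> X) (mu : probability X R).

Let mcst : measurable_fun [set: X] (fun=> (mu : pprobability X R)).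
Proof. exact: measurable_cst. Qed.

(** The law of one step of [P] from the initial law [mu], obtained by
    composing [P] with the constant kernel of value [mu] so that the lemmas on
    compositions apply. *)
Definition kpush : set X -> \bar R := mkcomp_noparam (kprobability mcst) P point.

HB.instance Definition _ := Measure.on kpush.

Let kpushT : kpush setT = 1.
Proof.
rewrite /kpush /mkcomp_noparam /= /kcomp_noparam.
under eq_integral do rewrite prob_kernel.
by rewrite integral_cst // mul1e; exact: probability_setT.
Qed.

HB.instance Definition _ := Measure_isProbability.Build _ _ _ kpush kpushT.

Lemma kpushE A : kpush A = \int[mu]_x P x A.
Proof. by []. Qed.

Lemma integral_kpush (f : X -> \bar R) : (forall x, 0 <= f x) -> measurable_fun setT f ->
  \int[kpush]_x f x = \int[mu]_x kapp P f x.
Proof. exact: integral_mkcomp_noparam. Qed.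

End pushforward_by_kernel.

Section nonexpansive_coupling.
Context {R : realType} {E : completeMetricType R}.
Variables (P : R.-pker borel E ~> borel E) (Q : R.-pker borel (E * E) ~> borel (E * E)).
Hypothesis PQ : coupling_kernel P Q.
Hypothesis Q_nonexpansive : forall x y : E,
  kapp Q (fun z => (mdist z.1 z.2)%:E) (x, y) <= (mdist x y)%:E.

Let mD : measurable_fun [set: borel (E * E)] (fun z => (mdist z.1 z.2)%:E : \bar R).
Proof. by apply/measurable_EFinP; exact: mdist_measurable. Qed.

Let D0 (z : borel (E * E)) : 0 <= (mdist z.1 z.2)%:E.
Proof. by rewrite lee_fin mdist_ge0. Qed.

Lemma coupling_cost_ge0 n x y : 0 <= coupling_cost Q n x y.
Proof. exact: kapp_ge0. Qed.

Lemma coupling_cost_le_mdist n x y : coupling_cost Q n x y <= (mdist x y)%:E.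
Proof.
have Q_le (z : borel (E * E)) : kapp Q (EFin \o (fun z => mdist z.1 z.2)) z <= (mdist z.1 z.2)%:E.
  by case: z => x' y'; exact: Q_nonexpansive.
exact: (kapp_kiter_le mdist_measurable (fun=> mdist_ge0 _ _) Q_le n (x, y)).
Qed.

Lemma coupling_cost_measurable n x :
  measurable_fun [set: borel E] (coupling_cost Q n x).
Proof.
rewrite (_ : coupling_cost Q n x =
    kapp (kiter Q n) (fun z => (mdist z.1 z.2)%:E) \o (fun y => (x, y))) //.
by apply: measurableT_comp (borel_measurable_pair x); exact: kapp_measurable.
Qed.

(** The coupled distance does not increase on average, so [P^n f] keeps the
    slope of [f]: [mean_kmean_le] and the completeness theorem apply to it. *)
Lemma blip_kmean n f : blip 1 f -> blip 1 (kmean P n f).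
Proof.
move=> bf; split => [x|x y].
  rewrite Rintegral_ge0 /=; last by move=> y _; exact: blip_ge0 bf.
  rewrite -[leRHS](Rintegral_cst_probability (kiter_prob P n x)).
  apply: (le_Rintegral_blip _ bf (blip_cst ler01 (lexx 1%R))) => y; exact: blip_le bf.
rewrite -lee_fin mul1r (le_trans _ (coupling_cost_le_mdist n x y)) //.
rewrite (le_trans _ (coupling_cost_le PQ n x y bf)) // lee_fin ler_norm //.
Qed.

Lemma kmeanD m n f x : blip 1 f -> kmean P (m + n) f x = kmean P m (kmean P n f) x.
Proof.
move=> bf; apply: EFin_inj; rewrite (EFin_kmean P _ _ bf) (EFin_kmean P _ _ (blip_kmean n bf)).
have mEf : measurable_fun [set: borel E] (EFin \o f).
  by apply/measurable_EFinP; exact: blip_measurable bf.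
have f0 z : 0 <= (EFin \o f) z by rewrite lee_fin (blip_ge0 z bf).
rewrite kapp_kiterD //; congr (kapp _ _ x); apply/funext => y.
by rewrite -(EFin_kmean P _ _ bf).
Qed.

Lemma Rintegral_kmean1 (mu : probability (borel E) R) f : blip 1 f ->
  (\int[kpush P mu]_x f x = \int[mu]_x kmean P 1 f x)%R.
Proof.
move=> bf; apply: EFin_inj.
have mEf : measurable_fun [set: borel E] (EFin \o f).
  by apply/measurable_EFinP; exact: blip_measurable bf.
have f0 z : 0 <= (EFin \o f) z by rewrite lee_fin (blip_ge0 z bf).
rewrite (EFin_Rintegral_blip _ bf) (EFin_Rintegral_blip _ (blip_kmean 1 bf)).
rewrite integral_kpush //; apply: eq_integral => y _.
by rewrite (EFin_kmean P _ _ bf) kapp_kiter1.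
Qed.

(** Test functions determine measures, so invariance can be tested on them. *)
Lemma invariantP (mu : probability (borel E) R) : invariant_probability P mu <->
  forall f, blip 1 f -> (\int[mu]_x kmean P 1 f x = \int[mu]_x f x)%R.
Proof.
split => [inv f bf|inv A mA].
  rewrite -Rintegral_kmean1 //; congr fine.
  by apply: eq_measure_integral => A mA _; exact: inv.
rewrite -kpushE; apply: (blip_measure_unique _ mA) => f bf.
by rewrite Rintegral_kmean1 // inv.
Qed.

Lemma invariant_kmean (mu : probability (borel E) R) n f : invariant_probability P mu ->
  blip 1 f -> (\int[mu]_x kmean P n f x = \int[mu]_x f x)%R.
Proof.
move=> /invariantP inv; elim: n f => [|n IH] f bf.
  apply: eq_Rintegral => x _; apply: EFin_inj.
  rewrite (EFin_kmean P _ _ bf) kapp_kiter0 //.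
  by apply/measurable_EFinP; exact: blip_measurable bf.
rewrite -(IH f bf) -(inv _ (blip_kmean n bf)).
by apply: eq_Rintegral => x _; rewrite -add1n kmeanD.
Qed.

(** [coupling_cost_le], averaged over the second starting point. *)
Lemma mean_kmean_le (nu : probability (borel E) R) n f x : blip 1 f ->
  (`|\int[nu]_y kmean P n f y - kmean P n f x|)%R%:E <= \int[nu]_y coupling_cost Q n x y.
Proof.
move=> bf; have bg := blip_kmean n bf; set g := kmean P n f in bg *.
have gx y : `|g x - g y|%:E <= coupling_cost Q n x y by exact: coupling_cost_le.
have mu_ := coupling_cost_measurable n x.
have u0 (y : borel E) : [set: borel E] y -> 0 <= coupling_cost Q n x y.
  by move=> _; exact: coupling_cost_ge0.
have g0 (y : borel E) : [set: borel E] y -> 0 <= (g y)%:E.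
  by move=> _; rewrite lee_fin (blip_ge0 y bg).
have mg : measurable_fun [set: borel E] (fun y => (g y)%:E : \bar R).
  by apply/measurable_EFinP; exact: blip_measurable bg.
have le1 : (\int[nu]_y g y)%R%:E <= (g x)%:E + \int[nu]_y coupling_cost Q n x y.
  rewrite (EFin_Rintegral_blip _ bg).
  have -> : (g x)%:E = \int[nu]_y (cst (g x)%:E y).
    by rewrite integral_cst //= probability_setT mule1.
  rewrite -ge0_integralD //; last by move=> y _; exact: g0.
  apply: ge0_le_integral => //; first exact: emeasurable_funD.
  move=> y _; have := gx y; case: (coupling_cost Q n x y) => [r| |]; last by [].
    by rewrite -EFinD !lee_fin ler_norml; lra.
  by move=> _; exact: leey.
have le2 : (g x)%:E <= (\int[nu]_y g y)%R%:E + \int[nu]_y coupling_cost Q n x y.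
  rewrite (EFin_Rintegral_blip _ bg).
  have -> : (g x)%:E = \int[nu]_y (cst (g x)%:E y).
    by rewrite integral_cst //= probability_setT mule1.
  rewrite -ge0_integralD //.
  apply: ge0_le_integral => //; [by move=> y _; exact: g0|exact: emeasurable_funD|].
  move=> y _; have := gx y; case: (coupling_cost Q n x y) => [r| |]; last by [].
    by rewrite -EFinD !lee_fin ler_norml; lra.
  by move=> _; exact: leey.
move: le1 le2; case: (\int[nu]_y coupling_cost Q n x y) => [r| |]; last by [].
  by rewrite -!EFinD !lee_fin ler_norml; lra.
by move=> _ _; rewrite leey.
Qed.

Hypothesis d_le1 : forall x y : E, (mdist x y <= 1)%R.
Hypothesis cost_cvg0 : forall x y : E, coupling_cost Q n x y @[n --> \oo] --> 0.

Lemma mean_cost_cvg0 (nu : probability (borel E) R) x :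
  \int[nu]_y coupling_cost Q n x y @[n --> \oo] --> 0.
Proof.
rewrite -(@integral0 _ _ _ nu setT); apply: bounded_convergence => //.
- by move=> n; exact: coupling_cost_measurable.
- move=> n y; rewrite coupling_cost_ge0 /=.
  by rewrite (le_trans (coupling_cost_le_mdist n x y)) // lee_fin.
- by move=> y; exact: cost_cvg0.
Qed.

Lemma mean_kmean_cvg0 (nu : probability (borel E) R) f x : blip 1 f ->
  (\int[nu]_y kmean P n f y - kmean P n f x)%R @[n --> \oo] --> (0 : R)%R.
Proof.
move=> bf; apply/cvgrPdist_le => e e0.
have /fine_cvgP[fin_cost /cvgrPdist_le/(_ e e0)] := mean_cost_cvg0 nu x.
move=> small; near=> n; rewrite sub0r normrN -lee_fin.
rewrite (le_trans (mean_kmean_le nu n x bf)) //.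
have fn : \int[nu]_y coupling_cost Q n x y \is a fin_num by near: n.
rewrite -(fineK fn) lee_fin.
have : (`|0 - fine (\int[nu]_y coupling_cost Q n x y)| <= e)%R by near: n.
by rewrite sub0r normrN; apply: le_trans; exact: ler_norm.
Unshelve. all: by end_near. Qed.

(** Each side is the limit of [P^n f] at one and the same point. *)
Lemma invariant_unique (mu nu : probability (borel E) R) :
  invariant_probability P mu -> invariant_probability P nu ->
  forall A : set (borel E), measurable A -> mu A = nu A.
Proof.
move=> imu inu; apply: blip_measure_unique => f bf.
have cvg_inv (m : probability (borel E) R) : invariant_probability P m ->
    kmean P n f point @[n --> \oo] --> (\int[m]_x f x)%R.
  move=> im; rewrite -[X in _ --> X]subr0.
  have -> : (fun n => kmean P n f point) = (fun n => \int[m]_x f x -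
      (\int[m]_y kmean P n f y - kmean P n f point))%R.
    by apply/funext => n; rewrite (invariant_kmean _ im bf); ring.
  by apply: cvgB; [exact: cvg_cst|exact: mean_kmean_cvg0].
exact: cvg_unique (cvg_inv mu imu) (cvg_inv nu inu).
Qed.

(** The uniform hypothesis makes [P^(n j + n k) f(x0)] close to [P^(n k) f(x0)],
    and by symmetry to [P^(n j) f(x0)], which yields a limit law by completeness.
    That [P f] is again a test function is what makes the limit invariant. *)
Lemma invariant_exists (n : nat -> nat) (x0 : E) : separable E ->
  {homo n : i j / (i < j)%N} ->
  (forall e : R, (0 < e)%R -> exists N, forall j k, (N <= k)%N ->
     \int[kiter_prob P (n j) x0]_y coupling_cost Q (n k) x0 y <= e%:E) ->
  exists pi : probability (borel E) R, invariant_probability P pi.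
Proof.
move=> sepE n_incr unif.
have n_cvg : n k @[k --> \oo] --> \oo.
  move=> A [N _ NA]; exists N => // k /= Nk; apply: NA => /=.
  exact: leq_trans Nk (increasing_ge_id k n_incr).
have close (e : R) : (0 < e)%R -> exists N, forall j k, (N <= k)%N -> forall f, blip 1 f ->
    (`|kmean P (n j + n k) f x0 - kmean P (n k) f x0| <= e)%R.
  move=> e0; have [N uN] := unif e e0; exists N => j k Nk f bf.
  by rewrite -lee_fin kmeanD // (le_trans (mean_kmean_le _ _ _ bf)) // uN.
have [|pi pi_lim] := bounded_lipschitz_complete (mu := fun k => kiter_prob P (n k) x0) sepE.
  move=> e e0; have [N cN] := close _ (divr_gt0 e0 (ltr0Sn R 1)).
  exists N => j k Nj Nk f bf.
  have := cN j k Nk f bf; have := cN k j Nj f bf.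
  by rewrite addnC /kmean !ler_norml; lra.
exists pi; apply/invariantP => f bf.
have lim1 := pi_lim _ bf; have lim2 := pi_lim _ (blip_kmean 1 bf).
have lim3 : (kmean P 1 (kmean P (n k) f) x0 - kmean P (n k) f x0)%R @[k --> \oo] --> (0 : R)%R.
  exact: cvg_comp n_cvg (mean_kmean_cvg0 (kiter_prob P 1 x0) x0 bf).
suff lim4 : kmean P (n k) (kmean P 1 f) x0 @[k --> \oo] --> (\int[pi]_x f x)%R.
  exact: cvg_unique lim2 lim4.
rewrite -[X in _ --> X]add0r.
rewrite (_ : (fun k => kmean P (n k) (kmean P 1 f) x0) =
  (fun k => (kmean P 1 (kmean P (n k) f) x0 - kmean P (n k) f x0)
   + kmean P (n k) f x0)%R); first exact: cvgD.
by apply/funext => k; rewrite subrK -kmeanD // addnC kmeanD.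
Qed.

End nonexpansive_coupling.

Lemma ereal_sup_le_real (R : realType) (S : set (\bar R)) : ereal_sup S < +oo ->
  exists2 M : R, (0 <= M)%R & forall x, S x -> x <= M%:E.
Proof.
move=> Soo; have S_le x : S x -> x <= ereal_sup S by exact: ereal_sup_ubound.
move: S_le Soo; case: (ereal_sup S) => // [r|] S_le _.
  exists (Num.max r 0%R); first by rewrite le_max lexx orbT.
  by move=> x /S_le /le_trans; apply; rewrite lee_fin le_max lexx.
by exists 0%R => // x /S_le /le_trans; apply; exact: leNye.
Qed.

Lemma expr_small (R : realType) (delta e : R) : (0 <= delta)%R -> (delta < 1)%R -> (0 < e)%R ->
  exists m, (delta ^+ m <= e)%R.
Proof.
move=> d0 d1 e0; have : (delta ^+ m @[m --> \oo] --> 0)%R.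
  by apply: cvg_expr; rewrite ger0_norm.
move=> /cvgrPdist_le/(_ _ e0)[m _ /(_ m (leqnn m))] /=.
by rewrite sub0r normrN ger0_norm ?exprn_ge0 // => ?; exists m.
Qed.

Section cost_decay.
Context {R : realType} {E : completeMetricType R}.
Variables (Q : R.-pker borel (E * E) ~> borel (E * E)).
Variables (V : E * E -> R) (delta c : R).
Hypotheses (delta0 : (0 <= delta)%R) (delta1 : (delta < 1)%R) (c0 : (0 <= c)%R).
Hypothesis V0 : forall z, (0 <= V z)%R.
Hypothesis cost_le1 : forall n x y, coupling_cost Q n x y <= 1.
Hypothesis decay : forall m n x y, n%:R%:E * coupling_cost Q n x y <=
  (n%:R * delta ^+ m + V (x, y) + c * m%:R)%:E.

Lemma coupling_costE n x y : coupling_cost Q n x y = (fine (coupling_cost Q n x y))%:E.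
Proof.
rewrite fineK // ge0_fin_numE; last by apply: kapp_ge0 => z; rewrite lee_fin mdist_ge0.
exact: le_lt_trans (cost_le1 n x y) (ltry _).
Qed.

Let cost_le m n x y : (0 < n)%N ->
  (fine (coupling_cost Q n x y) <= delta ^+ m + c * m%:R / n%:R + V (x, y) / n%:R)%R.
Proof.
move=> n0; have nR : (0 < n%:R :> R)%R by rewrite ltr0n.
have := decay m n x y; rewrite coupling_costE -EFinM lee_fin mulrC -ler_pdivlMr //.
by move=> /le_trans; apply; rewrite le_eqVlt; apply/orP; left; apply/eqP; field; rewrite gt_eqF.
Qed.

Let div_small (a e : R) : (0 <= a)%R -> (0 < e)%R ->
  exists N, forall n, (N <= n)%N -> (a / n.+1%:R <= e)%R.
Proof.
move=> a0 e0; exists (Num.truncn (a / e)) => n Nn.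
rewrite ler_pdivrMr // mulrC -ler_pdivrMr // ltW //.
by rewrite (lt_le_trans (truncnS_gt _)) // ler_nat.
Qed.

Lemma coupling_cost_cvg0 x y : coupling_cost Q n x y @[n --> \oo] --> 0.
Proof.
rewrite (_ : (fun n => coupling_cost Q n x y) =
  (fun n => (fine (coupling_cost Q n x y))%:E)); last first.
  by apply/funext => n; rewrite -coupling_costE.
apply: cvg_EFin; first exact: nearW.
apply/cvgrPdist_le => /= e e0; have e20 : (0 < e / 2)%R by rewrite divr_gt0.
have [m dm] := expr_small delta0 delta1 e20.
have [N VN] := div_small (addr_ge0 (mulr_ge0 c0 (ler0n R m)) (V0 (x, y))) e20.
exists N.+1 => // -[//|n] /= Nn.
rewrite sub0r normrN ger0_norm; last first.
  by rewrite fine_ge0 //; apply: kapp_ge0 => z; rewrite lee_fin mdist_ge0.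
apply: le_trans (cost_le m x y (ltn0Sn n)) _.
by rewrite [leRHS]splitr -addrA -mulrDl lerD // VN.
Qed.

Variables (psi : R -> R) (x0 : E).
Hypothesis psi_ge0 : forall v : R, (0 <= v)%R -> (0 <= psi v)%R.
Hypothesis psi_concave : concave_function `[0%R, +oo[ psi.
Hypothesis psi_lim : psi v @[v --> +oo%R] --> +oo%R.
Hypothesis mcost : forall n, measurable_fun [set: borel E] (coupling_cost Q n x0).
Hypothesis mV : measurable_fun [set: borel E] (fun y => V (x0, y)).

(** [m] is fixed first, to make [delta ^+ m] small.  The only term of the decay
    that is unbounded in [y] is [V / n], and since the cost is at most 1 only
    [min(1, V / n)] matters. *)
Lemma mean_cost_uniform (M e : R) : (0 <= M)%R -> (0 < e)%R ->
  exists N, forall n, (N <= n)%N -> forall nu : probability (borel E) R,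
    \int[nu]_y (psi (V (x0, y)))%:E <= M%:E ->
    \int[nu]_y coupling_cost Q n x0 y <= e%:E.
Proof.
move=> M0 e0; have e30 : (0 < e / 3)%R by rewrite divr_gt0.
have [m dm] := expr_small delta0 delta1 e30.
have [N cN] := div_small (mulr_ge0 c0 (ler0n R m)) e30.
have [A [_ psiA]] := (cvgryPge psi).1 psi_lim (3 * M / e + 1)%R.
exists (maxn N (Num.truncn A)).+1 => -[//|n]; rewrite ltnS geq_max => /andP[Nn An] nu nuM.
(* the + 1 keeps psi positive at n when M = 0 *)
have psin : (3 * M / e + 1 <= psi n.+1%:R)%R.
  by apply: psiA; rewrite (lt_le_trans (truncnS_gt A)) // ler_nat.
have Me : (0 <= 3 * M / e)%R by rewrite divr_ge0 // ?mulr_ge0 // ltW.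
have psi0 : (0 < psi n.+1%:R)%R by lra.
have Mpsi : ((psi n.+1%:R)^-1 * M <= e / 3)%R.
  rewrite mulrC ler_pdivrMr // -ler_pdivrMl //.
  by rewrite (le_trans _ psin) // invf_div; lra.
have -> : \int[nu]_y coupling_cost Q n.+1 x0 y = \int[nu]_y (fine (coupling_cost Q n.+1 x0 y))%:E.
  by apply: eq_integral => y _; rewrite -coupling_costE.
have mpsi : measurable_fun [set: borel E] (fun y => psi (V (x0, y))).
  exact: (concave_comp_measurable (V := fun y : borel E => V (x0, y))
    psi_concave psi_lim (fun y => V0 (x0, y)) mV).
have aff := @integral_affine_le _ (borel E) R nu (fun y => fine (coupling_cost Q n.+1 x0 y))
  (fun y => psi (V (x0, y))) (fun=> 0%R) (psi n.+1%:R)^-1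
  (delta ^+ m + c * m%:R / n.+1%:R)%R M 0%R.
apply: le_trans (aff _ _ _ _ _ _ _ _ _ _ nuM _) _ => //.
- by rewrite probability_le1.
- by rewrite invr_ge0 ltW.
- by rewrite addr_ge0 ?exprn_ge0 // divr_ge0 // mulr_ge0.
- by move=> y; rewrite fine_ge0 //; apply: kapp_ge0 => z; rewrite lee_fin mdist_ge0.
- by move=> y; exact: psi_ge0.
- exact: measurableT_comp.
- move=> y; rewrite addr0.
  have := concave_min_le psi_concave psi_ge0 psi_lim (V0 (x0, y)) (ltr0Sn R n) psi0.
  rewrite ge_min mulrC => minV.
  have f1 : (fine (coupling_cost Q n.+1 x0 y) <= 1)%R.
    by rewrite -lee_fin -coupling_costE.
  have d0 : (0 <= delta ^+ m)%R by rewrite exprn_ge0.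
  have cm0 : (0 <= c * m%:R / n.+1%:R)%R by rewrite divr_ge0 // mulr_ge0.
  case/orP : minV => [le1|leV].
    by rewrite (le_trans f1) // (le_trans le1) // lerDl addr_ge0.
  by apply: le_trans (cost_le m x0 y (ltn0Sn n)) _; rewrite addrC lerD2r.
- by rewrite integral0.
- rewrite lee_fin addr0 (_ : e = e / 3 + (e / 3 + e / 3))%R; last by field.
  by rewrite lerD // lerD // cN.
Qed.

End cost_decay.

Theorem theorem1 (R : realType) (E : completeMetricType R)
  (E_separable : separable E)
  (d_le1 : forall x y : E, (mdist x y <= 1)%R)
  (P : R.-pker borel E ~> borel E)
  (* (i) *)
  (Q : R.-pker borel (E * E) ~> borel (E * E))
  (Q_coupling : coupling_kernel P Q)
  (Delta : set (borel (E * E))) (Delta_meas : measurable Delta)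
  (l : nat) (l_ge1 : (1 <= l)%N) (eps : R) (eps_gt0 : (0 < eps)%R)
  (Q_contract : forall x y : E,
     kapp Q (fun z => (mdist z.1 z.2)%:E) (x, y) <= (mdist x y)%:E)
  (Ql_contract : forall x y : E, Delta (x, y) ->
     kapp (kiter Q l) (fun z => (mdist z.1 z.2)%:E) (x, y)
       <= ((1 - eps) * mdist x y)%:E)
  (* (ii) *)
  (V : borel (E * E) -> R) (V_meas : measurable_fun [set: borel (E * E)] V)
  (V_ge1 : forall x y : E, (1 <= V (x, y))%R)
  (b : R)
  (Q_drift : forall x y : E,
     kapp Q (fun z => (V z)%:E) (x, y)
       <= (V (x, y) - 1 + b * \1_Delta (x, y))%:E)
  (QV_bounded :
     ereal_sup [set kapp (kiter Q l.-1) (fun z => (V z)%:E) xy | xy in Delta]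
       < +oo)
  (* (iii) *)
  (n : nat -> nat) (n_incr : {homo n : i j / (i < j)%N})
  (psi : R -> R)
  (psi_ge0 : forall v : R, (0 <= v)%R -> (0 <= psi v)%R)
  (psi_concave : concave_function `[0%R, +oo[ psi)
  (psi_lim : psi v @[v --> +oo%R] --> +oo%R)
  (x0 : E)
  (P_psi_bounded :
     ereal_sup (range (fun k : nat =>
       kapp (kiter P (n k)) (fun y => (psi (V (x0, y)))%:E) x0)) < +oo)
  (PV_finite : kapp P (fun y => (V (x0, y))%:E) x0 < +oo) :
  exists pi : probability (borel E) R,
    invariant_probability P pi /\
    forall pi' : probability (borel E) R, invariant_probability P pi' ->
      forall A : set (borel E), measurable A -> pi' A = pi A.
Proof.
have V0 (z : borel (E * E)) : (0 <= V z)%R.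
  by case: z => x y; exact: le_trans ler01 (V_ge1 x y).
have [B B0 VB] := ereal_sup_le_real QV_bounded.
have [M M0 psiM] := ereal_sup_le_real P_psi_bounded.
(* the truncation at 0 is for eps > 1, where 1 - eps is not a contraction factor *)
pose delta := Num.max (1 - eps)%R 0%R.
have delta0 : (0 <= delta)%R by rewrite le_max lexx orbT.
have delta1 : (delta < 1)%R by rewrite gt_max ltr01 andbT; lra.
pose D (z : borel (E * E)) : R := mdist z.1 z.2.
have cost_le1 k x y : coupling_cost Q k x y <= 1.
  by rewrite (le_trans (coupling_cost_le_mdist Q_contract k x y)) // lee_fin.
pose c : R := (B + `|b| + l%:R)%R.
have c0 : (0 <= c)%R by rewrite !addr_ge0.
have QD (z : borel (E * E)) : kapp Q (EFin \o D) z <= (D z)%:E.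
  by case: z => x y; exact: Q_contract.
have QlD (z : borel (E * E)) : Delta z -> kapp (kiter Q l) (EFin \o D) z <= (delta * D z)%:E.
  case: z => x y Dxy; apply: le_trans (Ql_contract _ _ Dxy) _.
  by rewrite lee_fin ler_wpM2r ?mdist_ge0 // le_max lexx.
have QV (z : borel (E * E)) : kapp Q (EFin \o V) z <= (V z - 1 + b * \1_Delta z)%:E.
  by case: z => x y; exact: Q_drift.
have QlV (z : borel (E * E)) : Delta z -> kapp (kiter Q l.-1) (EFin \o V) z <= B%:E.
  by move=> Dz; apply: VB; exists z.
have decay m k x y : k%:R%:E * coupling_cost Q k x y <=
    (k%:R * delta ^+ m + V (x, y) + c * m%:R)%:E.
  have := drift_decay mdist_measurable V_meas (fun=> mdist_ge0 _ _) (fun=> d_le1 _ _)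
    V0 l_ge1 delta0 (ltW delta1) QD QlD QV QlV B0 m k (x, y).
  move=> /le_trans; apply.
  by rewrite lee_fin !lerD2r // ler_piMr // mulr_ge0 // exprn_ge0.
have cost_cvg := coupling_cost_cvg0 delta0 delta1 c0 V0 cost_le1 decay.
have mcost := coupling_cost_measurable Q.
have mV : measurable_fun [set: borel E] (fun y => V (x0, y)).
  exact: measurableT_comp V_meas (borel_measurable_pair x0).
have [|pi pi_inv] := invariant_exists Q_coupling Q_contract d_le1 cost_cvg
  (x0 := x0) E_separable n_incr.
  move=> e e0.
  have [N small] := mean_cost_uniform delta0 delta1 c0 V0 cost_le1 decay
    psi_ge0 psi_concave psi_lim (fun k => mcost k x0) mV M0 e0.
  exists N => j k Nk; apply: small.
    exact: leq_trans Nk (increasing_ge_id k n_incr).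
  by apply: psiM; exists j.
exists pi; split => // pi' pi'_inv; exact: (invariant_unique Q_coupling Q_contract d_le1 cost_cvg).
Qed.
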